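(* Let $R$ be a commutative Noetherian ring of prime characteristic $p$. Suppose that the Frobenius powers of the proper ideal $\mathfrak{a}$ of $R$ have linear growth of primary decompositions, and that $\bigcup_{n\in\mathbb{N}_0}\operatorname{ass}\mathfrak{a}^{[p^n]}$ is finite. Then (i) the ideal $\mathfrak{a}R^{\infty}$ of $R^{\infty}$ to which the $f$-sequence $\big((\mathfrak{a}^{[p^n]})^F\big)_{n\in\mathbb{N}_0}$ corresponds has a primary decomposition; (ii) the $f$-sequence $\big((\mathfrak{a}^{[p^n]})^F\big)_{n\in\mathbb{N}_0}$ has linear growth of primary decompositions; (iii) $\bigcup_{n\in\mathbb{N}_0}\operatorname{ass}(\mathfrak{a}^{[p^n]})^F\subseteq\bigcup_{n\in\mathbb{N}_0}\operatorname{ass}\mathfrak{a}^{[p^n]}$, and so the set $\bigcup_{n\in\mathbb{N}_0}\operatorname{ass}(\mathfrak{a}^{[p^n]})^F$ is finite; furthermore, if $R$ has a $p^{m_0}$-weak test element, for some $m_0\in\mathbb{N}_0$, then, in addition, (iv) $\mathfrak{a}^*S^{-1}R=(\mathfrak{a}S^{-1}R)^*$ for every multiplicatively closed subset $S$ of $R$; (v) the ideal of $R^{\infty}$ to which the $f$-sequence $\big((\mathfrak{a}^{[p^n]})^*\big)_{n\in\mathbb{N}_0}$ corresponds has a primary decomposition, so that the $f$-sequence $\big((\mathfrak{a}^{[p^n]})^*\big)_{n\in\mathbb{N}_0}$ has linear growth of primary decompositions; and (vi) $\bigcup_{n\in\mathbb{N}_0}\operatorname{ass}(\mathfrak{a}^{[p^n]})^*\subseteq\bigcup_{n\in\mathbb{N}_0}\operatorname{ass}(\mathfrak{a}^{[p^n]})^F$,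 so that the set $\bigcup_{n\in\mathbb{N}_0}\operatorname{ass}(\mathfrak{a}^{[p^n]})^*$ is finite.
   Context: Rings have identity; $\mathbb{N}_0$ is the set of non-negative integers. $f:R\to R$, $r\mapsto r^p$, is the Frobenius homomorphism. For an ideal $\mathfrak{b}$, the $n$-th Frobenius power $\mathfrak{b}^{[p^n]}$ is the ideal generated by all $p^n$-th powers of elements of $\mathfrak{b}$. The $F$-closure of an ideal $\mathfrak{b}$ of $R$ is $\mathfrak{b}^F=\{r\in R: r^{p^n}\in\mathfrak{b}^{[p^n]}\text{ for some }n\in\mathbb{N}_0\}$. For a commutative Noetherian ring $A$ of characteristic $p$, $A^{\circ}$ is the complement in $A$ of the union of the minimal primes of $A$. The tight closure $\mathfrak{b}^*$ of an ideal $\mathfrak{b}$ of $A$ is the ideal of all $r\in A$ for which there exists $c\in A^{\circ}$ with $cr^{p^n}\in\mathfrak{b}^{[p^n]}$ for all $n\gg0$. (Thus $(\mathfrak{a}S^{-1}R)^*$ is computed in $S^{-1}R$.) A $p^{m_0}$-weak test element for $A$ is an element $c\in A^{\circ}$ such that, for every ideal $\mathfrak{b}$ of $A$ and every $r\in A$, one has $r\in\mathfrak{b}^*$ if and only if $cr^{p^n}\in\mathfrak{b}^{[p^n]}$ for all $n\ge m_0$. Perfect closure: a ring of characteristic $p$ is perfect if its Frobenius homomorphism is bijective. $R^{\infty}$ is the perfect closure of $R$: a perfect commutative ring with a ring homomorphism $\psi_0:R\to R^{\infty}$ that is universal for ring homomorphisms from $R$ to perfect commutative rings of characteristic $p$.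 One has $\ker\psi_0=\sqrt{(0)}$, and each $\alpha\in R^\infty$ satisfies $\alpha^{p^m}\in\psi_0(R)$ for some $m\ge 0$. Put $\overline{r}=\psi_0(r)$, let $\overline{r}^{1/p^n}$ be its unique $p^n$-th root in $R^{\infty}$, and let $\psi_n:R\to R^{\infty}$ be the ring homomorphism $\psi_n(r)=\overline{r}^{1/p^n}$. $\mathfrak{a}R^{\infty}$ is the ideal generated by $\psi_0(\mathfrak{a})$. An $f$-sequence of ideals of $R$ is a sequence $(\mathfrak{a}_n)_{n\in\mathbb{N}_0}$ of ideals of $R$ with $f^{-1}(\mathfrak{a}_{n+1})=\mathfrak{a}_n$ for all $n$. The map $\mathfrak{A}\mapsto(\psi_n^{-1}(\mathfrak{A}))_{n\in\mathbb{N}_0}$ is a bijection from the set of ideals of $R^{\infty}$ to the set of $f$-sequences of ideals of $R$, with inverse $(\mathfrak{a}_n)_n\mapsto\bigcup_n\psi_n(\mathfrak{a}_n)$; ''corresponds'' refers to this bijection. The sequences $\big((\mathfrak{a}^{[p^n]})^F\big)_n$ and $\big((\mathfrak{a}^{[p^n]})^*\big)_n$ are $f$-sequences. An ideal of a (not necessarily Noetherian) commutative ring has a primary decomposition if it is an intersection of finitely many primary ideals. For an ideal $\mathfrak{b}$ of $R$, $\operatorname{ass}\mathfrak{b}$ is the set of associated primes of $\mathfrak{b}$, i.e. the radicals of the components of a minimal primary decomposition of $\mathfrak{b}$. A sequence $(\mathfrak{a}_n)_{n\in\mathbb{N}_0}$ of proper ideals of $R$ (either an $f$-sequence, or the sequence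 $(\mathfrak{a}^{[p^n]})_n$ of Frobenius powers of a proper ideal) has linear growth of primary decompositions if there is a positive integer $h$ such that for every $n\in\mathbb{N}_0$ there is a minimal primary decomposition $\mathfrak{a}_n=\mathfrak{q}_{1,n}\cap\cdots\cap\mathfrak{q}_{k_n,n}$ with $\big((\sqrt{\mathfrak{q}_{i,n}})^{[p^n]}\big)^h\subseteq\mathfrak{q}_{i,n}$ for all $i=1,\ldots,k_n$. *)

(* Defs.v *)
(* Ideals of a commutative ring A are sets [set A] satisfying [is_ideal].  Most
   notions are defined over a [comPzRingType], as a localization may be the zero
   ring. *)
From HB Require Import structures.
From mathcomp Require Import all_boot all_order all_algebra.
From mathcomp Require Import boolp classical_sets cardinality.

Set Implicit Arguments.
Unset Strict Implicit.
Unset Printing Implicit Defensive.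

Import GRing.Theory.
Local Open Scope classical_set_scope.
Local Open Scope ring_scope.

Section Ideals.
Variable A : comPzRingType.
Implicit Types (I J P Q b : set A) (X : set A).

Definition is_ideal I : Prop :=
  [/\ I 0, forall x y, I x -> I y -> I (x + y) & forall r x, I x -> I (r * x)].

Definition proper_id I : Prop := is_ideal I /\ ~ I 1.

Definition ideal_gen X : set A := smallest is_ideal X.

Definition ideal_mul I J : set A :=
  ideal_gen [set z | exists x y, [/\ I x, J y & z = x * y]].

Definition ideal_pow I (h : nat) : set A := iter h (ideal_mul I) setT.

Definition radical I : set A := [set x | exists n : nat, I (x ^+ n)].

Definition noetherian : Prop :=
  forall I, is_ideal I -> exists s : seq A, I = ideal_gen [set` s].

Definition is_prime P : Prop :=
  proper_id P /\ forall x y, P (x * y) -> P x \/ P y.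

Definition minimal_prime P : Prop :=
  is_prime P /\ forall Q, is_prime Q -> Q `<=` P -> Q = P.

(* The set denoted A^\circ in tight closure theory. *)
Definition circ : set A := ~` \bigcup_(P in minimal_prime) P.

Definition is_primary Q : Prop :=
  proper_id Q /\ forall x y, Q (x * y) -> Q x \/ radical Q y.

(* The empty family (k = 0) has intersection A, so it only decomposes A. *)
Definition primary_decomposition b (k : nat) (q : 'I_k -> set A) : Prop :=
  (forall i, is_primary (q i)) /\ b = \bigcap_i q i.

Definition has_primary_decomposition b : Prop :=
  exists (k : nat) (q : 'I_k -> set A), primary_decomposition b q.

Definition minimal_primary_decomposition b (k : nat) (q : 'I_k -> set A) :
    Prop :=
  [/\ primary_decomposition b q,
      forall i j, radical (q i) = radical (q j) -> i = j
    & forall i, ~ (\bigcap_(j in [set j | j <> i]) q j `<=` q i)].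

(* By the first uniqueness theorem the choice of decomposition is immaterial. *)
Definition ass b : set (set A) :=
  [set P | exists (k : nat) (q : 'I_k -> set A),
     minimal_primary_decomposition b q /\ exists i, P = radical (q i)].

End Ideals.

Section Frobenius.
Variables (p : nat) (A : comPzRingType).
Implicit Types b : set A.

Definition frob_power (n : nat) b : set A :=
  ideal_gen [set x ^+ (p ^ n) | x in b].

Definition frob_closure b : set A :=
  [set r | exists n : nat, frob_power n b (r ^+ (p ^ n))].

Definition tight_closure b : set A :=
  [set r | exists2 c, circ c &
     exists N : nat, forall n : nat, (N <= n)%N ->
       frob_power n b (c * r ^+ (p ^ n))].

Definition weak_test_element (m0 : nat) (c : A) : Prop :=
  circ c /\
  forall b, is_ideal b -> forall r,
    tight_closure b r <->
    forall n : nat, (m0 <= n)%N -> frob_power n b (c * r ^+ (p ^ n)).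

Definition f_sequence (a_ : nat -> set A) : Prop :=
  forall n, is_ideal (a_ n) /\ (fun x : A => x ^+ p) @^-1` a_ n.+1 = a_ n.

Definition linear_growth (a_ : nat -> set A) : Prop :=
  (forall n, proper_id (a_ n)) /\
  exists h : nat, (0 < h)%N /\
    forall n, exists (k : nat) (q : 'I_k -> set A),
      minimal_primary_decomposition (a_ n) q /\
      forall i, ideal_pow (frob_power n (radical (q i))) h `<=` q i.

End Frobenius.

Definition perfect (p : nat) (A : comNzRingType) : Prop :=
  p \in [pchar A] /\ bijective (fun x : A => x ^+ p).

Definition extension (A B : comPzRingType) (phi : {rmorphism A -> B})
    (b : set A) : set B := ideal_gen (phi @` b).

Definition perfect_closure (p : nat) (R Rinf : comNzRingType)
    (psi0 : {rmorphism R -> Rinf}) : Prop :=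
  perfect p Rinf /\
  forall (T : comNzRingType), perfect p T -> forall g : {rmorphism R -> T},
    exists h : {rmorphism Rinf -> T},
      h \o psi0 =1 g /\
      forall h' : {rmorphism Rinf -> T}, h' \o psi0 =1 g -> h' =1 h.

(* The p^n-th root of psi0 r: [xget] selects an element of the set, which is a
   singleton when Rinf is perfect. *)
Definition psi (p : nat) (R Rinf : comNzRingType)
    (psi0 : {rmorphism R -> Rinf}) (n : nat) (r : R) : Rinf :=
  xget 0 [set x : Rinf | x ^+ (p ^ n) = psi0 r].

(* The ideal of Rinf corresponding to the f-sequence a_. *)
Definition fseq_ideal (p : nat) (R Rinf : comNzRingType)
    (psi0 : {rmorphism R -> Rinf}) (a_ : nat -> set R) : set Rinf :=
  \bigcup_n (psi p psi0 n @` a_ n).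

Definition mult_closed (R : comPzRingType) (S : set R) : Prop :=
  S 1 /\ forall x y, S x -> S y -> S (x * y).

(* phi : R -> B exhibits B as the ring of fractions of R with respect to S. *)
Definition localization (R B : comPzRingType) (S : set R)
    (phi : {rmorphism R -> B}) : Prop :=
  [/\ forall s, S s -> exists u, phi s * u = 1,
      forall b, exists r s, S s /\ b * phi s = phi r
    & forall r, phi r = 0 <-> exists s, S s /\ s * r = 0].

Section FSequences.
Variables (p : nat) (A : comNzRingType).
Hypothesis pcharA : p \in [pchar A].
Implicit Types b : set A.

Lemma ideal_gen_ideal (X : set A) : is_ideal (ideal_gen X).
Proof.
split=> [I [[]//]|x y Ix Iy I II|r x Ix I II].
  by have [[_ D _] _] := II; apply: D; [apply: Ix|apply: Iy].
by have [[_ _ M] _] := II; apply: M; apply: Ix.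
Qed.

Lemma sub_ideal_gen (X : set A) : X `<=` ideal_gen X.
Proof. by move=> x Xx I [_]; apply. Qed.

Lemma expr_frobD n (x y : A) :
  (x + y) ^+ (p ^ n) = x ^+ (p ^ n) + y ^+ (p ^ n).
Proof.
by apply: exprDn_pchar; rewrite pnatX pnatE ?(pcharf_prime pcharA) ?pcharA.
Qed.

Lemma preim_frob_ideal n b : is_ideal b ->
  is_ideal [set x | b (x ^+ (p ^ n))].
Proof.
have p0 : (0 < p ^ n)%N by rewrite expn_gt0 prime_gt0 ?(pcharf_prime pcharA).
case=> b0 bD bM; split=> [|x y /= bx yb|r x /= bx].
- by rewrite /= expr0n eqn0Ngt p0.
- by rewrite expr_frobD; apply: bD.
- by rewrite exprMn; apply: bM.
Qed.

Lemma frob_powerD m n b : is_ideal b ->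
  frob_power p m (frob_power p n b) = frob_power p (n + m) b.
Proof.
move=> Ib; apply/seteqP; split.
  apply: smallest_sub; first exact: ideal_gen_ideal.
  move=> _ [x xb <-].
  suff /(_ _ xb) : frob_power p n b `<=`
    [set x | frob_power p (n + m) b (x ^+ (p ^ m))] by [].
  apply: smallest_sub; first exact/preim_frob_ideal/ideal_gen_ideal.
  move=> _ [y yb <-] /=; rewrite -exprM -expnD.
  by apply: sub_ideal_gen; exists y.
apply: smallest_sub; first exact: ideal_gen_ideal.
move=> _ [x xb <-]; rewrite expnD exprM; apply: sub_ideal_gen.
by exists (x ^+ (p ^ n)) => //; apply: sub_ideal_gen; exists x.
Qed.

Lemma frob_power_expr m n b (x : A) :
  frob_power p n b x -> frob_power p m (frob_power p n b) (x ^+ (p ^ m)).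
Proof. by move=> xb; apply: sub_ideal_gen; exists x. Qed.

Lemma frob_closure_ideal b : is_ideal b -> is_ideal (frob_closure p b).
Proof.
move=> Ib.
have up k n x : frob_power p n b (x ^+ (p ^ n)) ->
    frob_power p (n + k) b (x ^+ (p ^ (n + k))).
  by move=> xb; rewrite expnD exprM -frob_powerD//; apply: frob_power_expr.
split=> [|x y [n xb] [m yb]|r x [n xb]].
- have [f0 _ _] :=
    preim_frob_ideal 0 (@ideal_gen_ideal [set x ^+ (p ^ 0) | x in b]).
  by exists 0.
- exists (n + m)%N; rewrite expr_frobD.
  have [_ D _] := @ideal_gen_ideal [set x ^+ (p ^ (n + m)) | x in b].
  by apply: D; [apply: up|rewrite addnC; apply: up].
- exists n; rewrite exprMn.
  have [_ _ M] := @ideal_gen_ideal [set x ^+ (p ^ n) | x in b].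
  exact: M.
Qed.

Lemma frob_closure_f_sequence b : is_ideal b ->
  f_sequence p (fun n => frob_closure p (frob_power p n b)).
Proof.
move=> Ib n; split; first exact/frob_closure_ideal/ideal_gen_ideal.
apply/seteqP; split=> x [m] /=; rewrite frob_powerD//.
  by rewrite -exprM -expnS addSnnS -frob_powerD// => ?; exists m.+1.
move=> xb; exists m; rewrite frob_powerD// addSn -addn1 -frob_powerD//.
have := @frob_power_expr 1 _ _ _ xb.
by rewrite expn1 -!exprM mulnC.
Qed.

Lemma circM (c d : A) : circ c -> circ d -> circ (c * d).
Proof.
move=> cc cd [P mP Pcd].
have [_ /(_ _ _ Pcd)[Pc|Pd]] := mP.1; [apply: cc|apply: cd]; by exists P.
Qed.

Lemma circ1 : circ (1 : A).
Proof. by case=> P [[[_ P1] _] _]. Qed.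

Lemma tight_closure_ideal b : is_ideal b -> is_ideal (tight_closure p b).
Proof.
move=> Ib.
have FI n : is_ideal (frob_power p n b) by exact: ideal_gen_ideal.
split=> [|x y [c cc [N cx]] [d cd [M dy]]|r x [c cc [N cx]]].
- exists 1; first exact: circ1.
  exists 0 => n _; rewrite mul1r expr0n expn_eq0.
  by rewrite eqn0Ngt prime_gt0 ?(pcharf_prime pcharA)//=; have [] := FI n.
- exists (c * d); first exact: circM.
  exists (maxn N M) => n; rewrite geq_max => /andP[Nn Mn].
  have [_ FD FM] := FI n.
  rewrite expr_frobD mulrDr; apply: FD.
    by rewrite (mulrC c) -mulrA; apply: FM; apply: cx.
  by rewrite -mulrA; apply: FM; apply: dy.
- exists c => //; exists N => n Nn; rewrite exprMn mulrCA.
  by have [_ _ FM] := FI n; apply: FM; apply: cx.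
Qed.

Lemma tight_closure_f_sequence b : is_ideal b ->
  f_sequence p (fun n => tight_closure p (frob_power p n b)).
Proof.
move=> Ib n; split; first exact/tight_closure_ideal/ideal_gen_ideal.
apply/seteqP; split=> x [c cc [N cx]]; exists c => //.
  exists N.+1 => -[//|m Nm]; rewrite frob_powerD// addnS -addSn -frob_powerD//.
  by rewrite expnS exprM; apply: cx.
exists N => m Nm; rewrite frob_powerD// addSn -addnS -frob_powerD//=.
by rewrite -exprM -expnS; apply: cx; apply: leqW.
Qed.

End FSequences.

(* Main.v *)
(* With h as in the linear growth of (a^[p^n])_n and Lambda the finite union of
   the sets ass a^[p^n], let C_P,n, for P in Lambda, be the set of the r with
     s r^(p^j) \in a^[p^(n+j)] + (P^[p^(n+j)])^h  for some j and s \notin P.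
   Adding the powers of P makes (C_P,n)_n an f-sequence of P-primary ideals, and
   linear growth says precisely that the added terms lie in the P-component of
   a^[p^(n+j)], so that (a^[p^n])^F is the intersection of the C_P,n.  As Lambda
   does not depend on n, this decomposition passes to the perfect closure.
   With a weak test element c, the tight closures decompose in the same way
   into the components {r | c r^(p^m) \in C_P,n+m for all m}, each of which is
   P-primary or the whole ring; they are proper by Krull's intersection theorem.
   Localization commutes with tight closure of a because, for P disjoint from S,
   the multipliers s_n \in S that arise at each level n can be cancelled modulo
   the P-primary ideal C_P,n, and for the other P one s \in S lying in C_P,0
   serves all n, as s^(p^n) lies in C_P,n. *)
Require Import Defs.
From HB Require Import structures.
From mathcomp Require Import all_boot all_order all_algebra.
From mathcomp Require Import boolp classical_sets cardinality.
From mathcomp Require Import functions ring_quotient.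

Set Implicit Arguments.
Unset Strict Implicit.
Unset Printing Implicit Defensive.

Import GRing.Theory.
Local Open Scope classical_set_scope.
Local Open Scope ring_scope.

(** * Ideals and primary decompositions *)

Section Ideals.
Context {A : comPzRingType}.
Implicit Types (I J P Q b X : set A) (x y z : A).

Lemma ideal_gen_is_ideal X : is_ideal (ideal_gen X).
Proof.
split=> [I [[]//]|x y Ix Iy I II|r x Ix I II].
  by have [[_ D _] _] := II; apply: D; [apply: Ix|apply: Iy].
by have [[_ _ M] _] := II; apply: M; apply: Ix.
Qed.

Lemma mem_ideal_gen X x : X x -> ideal_gen X x.
Proof. by move=> Xx I [_]; apply. Qed.

Lemma ideal_mulr I x y : is_ideal I -> I x -> I (x * y).
Proof. by case=> _ _ M Ix; rewrite mulrC; apply: M. Qed.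

Lemma ideal_opp I x : is_ideal I -> I x -> I (- x).
Proof. by case=> _ _ M Ix; rewrite -mulN1r; apply: M. Qed.

Lemma ideal_sub I x y : is_ideal I -> I x -> I y -> I (x - y).
Proof. by move=> II Ix Iy; have [_ D _] := II; apply: D => //;
  apply: ideal_opp. Qed.

Lemma ideal_expr I x n : is_ideal I -> (0 < n)%N -> I x -> I (x ^+ n).
Proof. by move=> II; case: n => // n _ Ix; rewrite exprS;
  apply: ideal_mulr. Qed.

Lemma ideal_exprW I x m n :
  is_ideal I -> (m <= n)%N -> I (x ^+ m) -> I (x ^+ n).
Proof.
by move=> II mn Ix; rewrite -(subnKC mn) exprD; apply: ideal_mulr.
Qed.

Lemma ideal_sum (T : Type) (r : seq T) (C : pred T) (F : T -> A) I :
  is_ideal I -> (forall i, C i -> I (F i)) -> I (\sum_(i <- r | C i) F i).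
Proof. by move=> [I0 ID _] IF; apply: big_ind. Qed.

Lemma ideal_prod (T : eqType) (r : seq T) (C : pred T) (F : T -> A) I i :
  is_ideal I -> i \in r -> C i -> I (F i) -> I (\prod_(j <- r | C j) F j).
Proof.
by move=> II ir Ci Ii; rewrite (big_rem i ir) Ci; apply: ideal_mulr.
Qed.

Lemma ideal_bigcap (T : Type) (D : set T) (F : T -> set A) :
  (forall i, D i -> is_ideal (F i)) -> is_ideal (\bigcap_(i in D) F i).
Proof.
move=> IF; split=> [i /IF[]//|x y Fx Fy i Di|r x Fx i Di].
  by have [_ FD _] := IF i Di; apply: FD; [apply: Fx|apply: Fy].
by have [_ _ FM] := IF i Di; apply: FM; apply: Fx.
Qed.

Lemma ideal1P I : is_ideal I -> I 1 -> I = setT.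
Proof.
by move=> II I1; apply/seteqP; split=> // x _; rewrite -(mulr1 x);
  have [_ _] := II; apply.
Qed.

Definition ideal_add I J : set A := ideal_gen (I `|` J).

Lemma ideal_add_sub I J K :
  is_ideal K -> I `<=` K -> J `<=` K -> ideal_add I J `<=` K.
Proof. by move=> IK IK' JK; apply: smallest_sub => // x [/IK'|/JK]. Qed.

Lemma ideal_adjoinP I x : is_ideal I ->
  ideal_add I [set x] = [set y | exists i r, I i /\ y = i + r * x].
Proof.
move=> II; apply/seteqP; split.
  have [I0 ID IM] := II.
  apply: smallest_sub => [|y [Iy|->]]; first split.
  - by exists 0, 0; rewrite mul0r addr0.
  - move=> _ _ [i [r [Ii ->]]] [j [s [Ij ->]]]; exists (i + j), (r + s).
    by rewrite mulrDl addrACA; split=> //; apply: ID.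
  - move=> t _ [i [r [Ii ->]]]; exists (t * i), (t * r).
    by rewrite mulrDr mulrA; split=> //; apply: IM.
  - by exists y, 0; rewrite mul0r addr0.
  - by exists 0, 1; rewrite mul1r add0r.
have [_ GD GM] := ideal_gen_is_ideal (I `|` [set x]).
move=> _ [i [r [Ii ->]]]; apply: GD; first by apply: mem_ideal_gen; left.
by apply: GM; apply: mem_ideal_gen; right.
Qed.

Lemma ideal_pow_expr I x n : I x -> ideal_pow I n (x ^+ n).
Proof.
move=> Ix; elim: n => //= n IHn; apply: mem_ideal_gen.
by exists x, (x ^+ n); rewrite exprS.
Qed.

Lemma ideal_pow_sub I J n :
  is_ideal J -> (0 < n)%N -> I `<=` J -> ideal_pow I n `<=` J.
Proof.
move=> IJ; case: n => // n _ IJ'; apply: smallest_sub => //.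
by move=> _ [x [y [/IJ' Jx _ ->]]]; apply: ideal_mulr.
Qed.

Lemma radical_is_ideal I : is_ideal I -> is_ideal (radical I).
Proof.
move=> II; have [I0 ID IM] := II; split=> [|x y [m Ix] [n Iy]|r x [n Ix]].
- by exists 1%N; rewrite expr1.
- exists (m + n)%N; rewrite exprDn; apply: ideal_sum => // i _.
  rewrite -mulr_natr; apply: ideal_mulr => //.
  have [mi|im] := leqP n i.
    by apply: IM; apply: ideal_exprW mi _.
  apply: ideal_mulr => //; apply: ideal_exprW Ix => //.
  by rewrite -addnBA ?leq_addr// ltnW.
- by exists n; rewrite exprMn; apply: IM.
Qed.

Lemma sub_radical I : I `<=` radical I.
Proof. by move=> x Ix; exists 1%N; rewrite expr1. Qed.

Lemma prime_expr P x n : is_prime P -> P (x ^+ n) -> P x.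
Proof.
case=> [[_ P1] PM]; elim: n => [/P1//|n IHn].
by rewrite exprS => /PM[].
Qed.

Lemma prime_radical I P : is_prime P -> I `<=` P -> radical I `<=` P.
Proof. by move=> pP IP x [n /IP]; apply: prime_expr. Qed.

Lemma prime_prod (T : Type) (r : seq T) (C : pred T) (F : T -> A) P :
  is_prime P -> (forall i, C i -> ~ P (F i)) -> ~ P (\prod_(i <- r | C i) F i).
Proof.
move=> [[_ P1] PM] PF.
by apply: (big_ind (fun x => ~ P x)) => // x y Px Py /PM[].
Qed.

Lemma radical_primary_prime Q : is_primary Q -> is_prime (radical Q).
Proof.
move=> [[IQ Q1] QM]; split; first split; first exact: radical_is_ideal.
  by case=> n; rewrite expr1n.
move=> x y [n]; rewrite exprMn => /QM[]; first by left; exists n.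
by case=> m; rewrite -exprM; right; exists (n * m)%N.
Qed.

(* If P is the radical of the i0-th component of a minimal decomposition and x
   lies in all components of it but that one, then P is the radical of (b : x),
   hence of some (q i : x). *)
Lemma ass_sub_radical b k (q : 'I_k -> set A) P :
  primary_decomposition b q -> ass b P -> exists i, P = radical (q i).
Proof.
move=> [qp bE] [k' [q' [[[q'p bE'] _ irr] [i0 PE]]]].
have pP : is_prime P by rewrite PE; apply: radical_primary_prime.
have [[IP P1] PM] := pP.
have /nonsubset[x [xq' xi0]] := irr i0.
have PP y : P y -> exists n, b (x * y ^+ n).
  rewrite PE => -[n yn]; exists n; rewrite bE' => j _.
  have [[Iq' _] _] := q'p j.
  have [ji|/eqP ji] := eqVneq j i0.
    by rewrite -ji in yn; have [_ _] := Iq'; apply.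
  by apply: ideal_mulr => //; apply: xq'.
have PP' y : b (x * y) -> P y.
  rewrite bE' PE => /(_ i0 I) /= xy.
  by have [_ /(_ _ _ xy)[]] := q'p i0.
apply: contrapT => /forallNP nP.
(* If P differed from all the radicals, some z outside P would push x into each [q i]; the product
   of these z would lie in (b : x), hence in P. *)
have /choice[z zP] : forall i, exists z, ~ P z /\ q i (x * z).
  move=> i; have [[Iq q1] qM] := qp i.
  have [xqi|xqi] := pselect (q i x); first by exists 1; rewrite mulr1.
  have Psub : P `<=` radical (q i).
    move=> y /PP[n]; rewrite bE => /(_ i I) /qM[//|[m]].
    by rewrite -exprM; exists (n * m)%N.
  have /nonsubset[y [[n yn] yP]] : ~ (radical (q i) `<=` P).
    by move=> /(conj Psub)/seteqP; apply: nP.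
  exists (y ^+ n); split; first by move/(prime_expr pP).
  by have [_ _] := Iq; apply.
apply: (@prime_prod _ (index_enum 'I_k) xpredT z P pP).
  by move=> i _; case: (zP i).
apply: PP'; rewrite bE => i _; rewrite (bigD1 i)//= mulrA.
by apply: ideal_mulr; [case: (qp i) => -[]|case: (zP i)].
Qed.

(** Redundant components are dropped one at a time; a subfamily keeps distinct radicals, so no
    components have to be merged. *)
Lemma minimal_subdecomposition k (q : 'I_k -> set A) :
  (forall i, is_primary (q i)) ->
  (forall i j, radical (q i) = radical (q j) -> i = j) ->
  exists k' (f : 'I_k' -> 'I_k),
    minimal_primary_decomposition (\bigcap_i q i) (q \o f).
Proof.
elim: k q => [|k IHk] q qp qi.
  by exists 0%N, id; split=> // -[].
have [irr|/existsNP[i /contrapT red]] := pselect (forall i,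
    ~ (\bigcap_(j in [set j | j <> i]) q j `<=` q i)).
  by exists k.+1, id.
have [|j j' /qi /lift_inj//|k' [f fP]] := IHk (q \o lift i).
  by move=> j; apply: qp.
exists k', (lift i \o f).
suff -> : \bigcap_i q i = \bigcap_j (q \o lift i) j by [].
apply/seteqP; split=> x qx j _; first exact: (qx (lift i j) I).
have qx' : (\bigcap_(j in [set j | j <> i]) q j) x.
  move=> j' /= /eqP; rewrite eq_sym => /unlift_some[j'' -> _].
  exact: (qx j'' I).
have [->|/eqP ji] := eqVneq j i; first exact: red.
exact: qx'.
Qed.

End Ideals.

(** * Noetherian rings and minimal primes *)

Lemma minimal_in_seq (T : eqType) (le : T -> T -> Prop) (s : seq T) x :
  (forall x, le x x) -> (forall y x z, le x y -> le y z -> le x z) ->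
  x \in s ->
  exists y, [/\ y \in s, le y x & forall z, z \in s -> le z y -> le y z].
Proof.
move=> lexx le_trans; elim: s x => // a s IHs.
have lift x y : y \in s -> le y x ->
    (forall z, z \in s -> le z y -> le y z) ->
    exists y, [/\ y \in a :: s, le y x &
      forall z, z \in a :: s -> le z y -> le y z].
  move=> ys yx ymin; have [ay|ay] := pselect (le a y).
    exists a; split=> [||z]; [exact: mem_head|exact: le_trans yx|].
    rewrite inE => /predU1P[->//|zs za].
    by apply: (le_trans _ _ _ ay); apply: ymin => //; apply: le_trans ay.
  exists y; split=> [||z]; [by rewrite inE ys orbT|by []|].
  by rewrite inE => /predU1P[->//|]; apply: ymin.
move=> x; rewrite inE => /predU1P[->|/IHs[y [ys yx ymin]]];
  last exact: lift ymin.
have [[z [zs za]]|nz] := pselect (exists z, z \in s /\ le z a).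
  have [y [ys yz ymin]] := IHs _ zs.
  by apply: lift ymin => //; apply: le_trans za.
exists a; split=> [||z]; [exact: mem_head|by []|].
by rewrite inE => /predU1P[->//|zs za]; case: nz; exists z.
Qed.

Section Noetherian.
Context {A : comPzRingType}.
Hypothesis noethA : noetherian A.
Implicit Types (I J P Q : set A) (x y z : A).

Lemma noetherian_maximal (F : set (set A)) :
  (forall J, F J -> is_ideal J) -> F !=set0 ->
  exists2 M, F M & forall N, F N -> M `<=` N -> N `<=` M.
Proof.
move=> FI [I0 FI0]; apply: contrapT => /forall2NP nomax.
(* Without a maximal member, [g] picks strictly larger members; the union of its iterates [U n] is
   finitely generated, so it equals some [U N]. *)
have /choice[g gP] : forall J : {J | F J}, exists K : {K | F K},
    sval J `<=` sval K /\ ~ sval K `<=` sval J.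
  move=> [J FJ]; have [//|] := nomax J.
  by move=> /existsNP[K /not_implyP[FK /not_implyP[JK KJ]]];
    exists (exist _ K FK).
pose U n := sval (iter n g (exist _ I0 FI0)).
have FU n : is_ideal (U n) by apply: FI; exact: (svalP (iter n g (exist _ I0
  FI0))).
have UD m n : U m `<=` U (m + n)%N.
  elim: n => [|n IHn]; first by rewrite addn0.
  by rewrite addnS; apply: (subset_trans IHn);
    case: (gP (iter (m + n) g (exist _ I0 FI0))).
have [|s sE] := noethA (I := \bigcup_n U n).
  split; first by exists 0%N => //; case: (FU 0%N).
    move=> x y [m _ xm] [n _ yn]; exists (m + n)%N => //.
    have [_ FD _] := FU (m + n)%N; apply: FD; first exact: UD xm.
    by rewrite addnC; apply: UD yn.
  by move=> r x [n _ xn]; exists n => //; have [_ _] := FU n; apply.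
have [N sN] : exists N, {in s, forall x, U N x}.
  have : {in s, forall x, (\bigcup_n U n) x}.
    by move=> x xs; rewrite sE; apply: mem_ideal_gen.
  elim: s {sE} => [|x s IHs] sU; first by exists 0%N.
  have [|N sN] := IHs; first by move=> y ys; apply: sU; rewrite inE ys orbT.
  have [m _ xm] := sU x (mem_head _ _).
  exists (N + m)%N => y; rewrite inE => /predU1P[->|/sN]; last exact: UD.
  by rewrite addnC; apply: UD xm.
have [_ nsub] := gP (iter N g (exist _ I0 FI0)); apply: nsub => x xN.
suff /(_ x) : \bigcup_n U n `<=` U N by apply; exists N.+1.
by rewrite sE; apply: smallest_sub.
Qed.

(* The primes in s may repeat, but equal primes get equal factors f P: this is
   weaker than I containing the product of the ideals in s. *)
Lemma noetherian_prime_product I : is_ideal I ->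
  exists s : seq (set A), (forall P, P \in s -> is_prime P /\ I `<=` P) /\
    forall f : set A -> A, {in s, forall P, P (f P)} -> I (\prod_(P <- s) f P).
Proof.
move=> II; apply: contrapT => nI.
(* [F] collects the counterexamples. A maximal one [J] turns out to be prime, and then the list
   consisting of [J] alone refutes it. *)
pose F := [set J : set A | is_ideal J /\ ~ exists s : seq (set A),
  (forall P, P \in s -> is_prime P /\ J `<=` P) /\
    forall f : set A -> A, {in s, forall P, P (f P)} -> J (\prod_(P <- s) f P)].
have [J []//||J [IJ nJ] Jmax] := @noetherian_maximal F; first by exists I.
have J1 : ~ J 1.
  by move=> J1; apply: nJ; exists [::]; split=> // f _; rewrite big_nil.
have subJ x : J `<=` ideal_add J [set x].
  by move=> y Jy; apply: mem_ideal_gen; left.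
have extJ x : ~ J x -> exists s : seq (set A),
    (forall P, P \in s -> is_prime P /\ J `<=` P) /\
    forall f : set A -> A, {in s, forall P, P (f P)} ->
      ideal_add J [set x] (\prod_(P <- s) f P).
  move=> Jx; have /not_andP[[]|] : ~ F (ideal_add J [set x]).
  - move=> /Jmax /(_ (subJ x) x) Jx'.
    by apply/Jx/Jx'; apply: mem_ideal_gen; right.
  - exact: ideal_gen_is_ideal.
  move=> /contrapT[s [sP fs]]; exists s; split=> // P /sP[pP JP].
  by split=> //; apply: subset_trans JP.
apply: (nJ); exists [:: J]; split=> [P|f fJ]; last first.
  by rewrite big_seq1; apply: fJ; rewrite mem_head.
rewrite inE => /eqP {P}->; split=> //; split=> // x y Jxy.
apply: contrapT => /not_orP[/extJ[s [sP fs]] /extJ[t [tP ft]]].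
(* As xy lies in J, so does the product of J + (x) and J + (y); the concatenated list therefore
   works for J. *)
apply: nJ; exists (s ++ t); split=> [P|f fP].
  by rewrite mem_cat => /orP[/sP|/tP].
have : ideal_add J [set x] (\prod_(P <- s) f P).
  by apply: fs => P Ps; apply: fP; rewrite mem_cat Ps.
have : ideal_add J [set y] (\prod_(P <- t) f P).
  by apply: ft => P Pt; apply: fP; rewrite mem_cat Pt orbT.
rewrite !ideal_adjoinP// big_cat => -[j [r' [Jj /= ->]]] [i [r [Ji ->]]].
have [_ JD JM] := IJ.
rewrite mulrDl; apply: (JD); first exact: ideal_mulr.
rewrite mulrDr; apply: JD; first exact: JM.
by rewrite mulrACA; apply: JM.
Qed.

(** A list [s] is taken for the zero ideal. A prime containing no member of [s] would omit one of
    the products, yet these vanish; so the minimal primes are the minimal members of [s]. An element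
    of all of them lies in every member of [s], and its power of exponent [size s] is one of the
    products. *)
Lemma noetherian_minimal_primes : exists l : seq (set A),
  [/\ forall P, P \in l <-> minimal_prime P,
      forall Q, is_prime Q -> exists2 P, minimal_prime P & P `<=` Q
    & forall x, (forall P, minimal_prime P -> P x) -> exists n, x ^+ n = 0].
Proof.
have [|s [sP fs]] := @noetherian_prime_product [set 0].
  by split=> [//|x y -> ->|r x ->]; rewrite ?addr0 ?mulr0.
have below Q : is_prime Q -> exists2 P, P \in s & P `<=` Q.
  move=> pQ; apply: contrapT => /forall2NP nPQ.
  have /choice[f fP] : forall P, exists x, P \in s -> P x /\ ~ Q x.
    move=> P; have [Ps|nPs] := boolP (P \in s).
      by have [//|/nonsubset[x [Px Qx]]] := nPQ P; exists x.
    by exists 0.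
  have [[IQ _] _] := pQ; have [Q0 _ _] := IQ.
  have : ~ Q (\prod_(P <- s | P \in s) f P).
    by apply: prime_prod => // P /fP[].
  by rewrite -big_seq fs// => P /fP[].
have minbelow Q : is_prime Q -> exists2 P, minimal_prime P & P `<=` Q.
  move=> /below[P0 P0s P0Q].
  have [P [Ps PP0 Pmin]] := @minimal_in_seq _ (@subset A) s P0
    (@subset_refl A) (fun Y X Z => @subset_trans A Y X Z) P0s.
  exists P; last exact: subset_trans P0Q.
  split=> [|Q' pQ' Q'P]; first by case: (sP _ Ps).
  have [P' P's P'Q'] := below _ pQ'; apply/seteqP; split=> //.
  apply: (subset_trans _ P'Q'); apply: Pmin => //; exact: (subset_trans P'Q').
exists [seq P <- s | `[< minimal_prime P >]]; split=> // [P|x xP].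
  rewrite mem_filter; split=> [/andP[/asboolP]//|mP].
  apply/andP; split; first exact/asboolP.
  have [P' P's P'P] := below _ mP.1.
  by rewrite -(mP.2 P')//; case: (sP _ P's).
exists (size s).
suff <- : \prod_(P <- s) x = x ^+ size s.
  by apply: (fs (fun=> x)) => P /sP[/minbelow[P' /xP P'x P'P] _]; apply: P'P.
by rewrite big_const_seq count_predT -Monoid.iteropE.
Qed.

(** [e] sums, over the minimal primes Q containing [d], a product of elements of the other minimal
    primes chosen outside Q. A minimal prime P without [d] contains every summand; a P with [d]
    contains all but the summand of Q = P, so [d + e ^+ n] lies outside P. *)
Lemma circ_radical_avoidance (d : A) : exists e : A,
  (forall P, minimal_prime P -> ~ P d -> P e) /\
  (forall n, (0 < n)%N -> circ (d + e ^+ n)).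
Proof.
have [l [lP _ _]] := noetherian_minimal_primes.
have /choice[u uP] : forall PQ : set A * set A, exists u,
    minimal_prime PQ.1 -> minimal_prime PQ.2 -> PQ.1 <> PQ.2 ->
    PQ.1 u /\ ~ PQ.2 u.
  move=> [P Q]; apply: contrapT => /forallNP nPQ.
  have := nPQ 0 => /not_implyP[mP /not_implyP[mQ /not_implyP[PQ _]]].
  apply: PQ => /=; apply: mQ.2; first exact: mP.1.
  move=> x Px; apply: contrapT => Qx; apply: (nPQ x) => _ _ _.
  by split.
(* Repetitions are removed so that the summand of P occurs only once in [e]. *)
pose m := undup l.
have mP P : P \in m -> minimal_prime P by rewrite mem_undup => /lP.
pose e := \sum_(Q <- m | `[< Q d >]) \prod_(P <- m | P != Q) u (P, Q).
have others P Q : P \in m -> Q \in m -> Q != P ->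
    P (\prod_(P' <- m | P' != Q) u (P', Q)).
  move=> Pm Qm /eqP QP; have [[[IP _] _] _] := mP _ Pm.
  apply: (@ideal_prod _ _ _ _ _ _ P) => //; first by apply/eqP => /esym/QP.
  exact: (uP (P, Q) (mP _ Pm) (mP _ Qm) (fun E => QP (esym E))).1.
have eP P : minimal_prime P -> ~ P d -> P e.
  move=> mpP Pd; have [[[IP _] _] _] := mpP.
  rewrite /e big_seq_cond; apply: ideal_sum => // Q /andP[Qm /asboolP Qd].
  apply: others => //; first by rewrite mem_undup lP.
  by apply/eqP => QP; rewrite QP in Qd.
exists e; split=> // n n0 [P mpP Pden].
have [[[IP _] _] _] := mpP.
have [Pd|Pd] := pselect (P d); last first.
  have Pe := eP _ mpP Pd; apply: Pd; rewrite -(addrK (e ^+ n) d).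
  by apply: ideal_sub => //; apply: ideal_expr.
have := ideal_sub IP Pden Pd; rewrite addrC addKr => /(prime_expr mpP.1).
have Pm : P \in m by rewrite mem_undup lP.
have Prest :
    P (\sum_(Q <- rem P m | `[< Q d >]) \prod_(P' <- m | P' != Q) u (P', Q)).
  rewrite big_seq_cond; apply: ideal_sum => // Q.
  rewrite mem_rem_uniq ?undup_uniq// => /andP[/andP[/= QP Qm] _].
  exact: others.
rewrite /e (big_rem P Pm) asboolT// => Pe.
have := ideal_sub IP Pe Prest; rewrite addrK big_seq_cond.
apply: prime_prod => [|P' /andP[P'm /eqP P'P]]; first exact: mpP.1.
exact: (uP (P', P) (mP _ P'm) mpP P'P).2.
Qed.

End Noetherian.

(** * Primary decompositions indexed by a finite set of primes *)

Lemma finite_set_enum (T : eqType) (D : set T) : finite_set D ->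
  exists k (r : 'I_k -> T), injective r /\ D = range r.
Proof.
move=> /finite_seqP[s ->]; exists (size (undup s)), (tnth (in_tuple (undup s))).
split=> [|]; first by apply/tuple_uniqP; rewrite undup_uniq.
apply/seteqP; split=> [x /= xs|_ [i _ <-]].
  have : x \in in_tuple (undup s) by rewrite mem_undup.
  by move=> /tnthP[i ->]; exists i.
by rewrite /= -mem_undup; apply: (mem_tnth i (in_tuple (undup s))).
Qed.

Section PrimaryFamily.
Context {A : comPzRingType}.
Implicit Types (d : set A) (D : set (set A)) (q : set A -> set A).

Lemma has_primary_decomposition_family (T : eqType) (D : set T)
    (q : T -> set A) : finite_set D ->
  (forall P, D P -> is_primary (q P)) ->
  has_primary_decomposition (\bigcap_(P in D) q P).
Proof.
move=> /finite_set_enum[k [r [_ ->]]] qp; exists k, (q \o r); split=> [i|].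
  by apply: qp; exists i.
by rewrite bigcap_image.
Qed.

Lemma minimal_primary_family D q : finite_set D ->
  (forall P, D P -> is_primary (q P) /\ radical (q P) = P) ->
  exists k (r : 'I_k -> set A), (forall i, D (r i)) /\
    minimal_primary_decomposition (\bigcap_(P in D) q P) (q \o r).
Proof.
move=> /finite_set_enum[k [r [r_inj ->]]] qp.
have qr i : is_primary (q (r i)) /\ radical (q (r i)) = r i.
  by apply: qp; exists i.
have [i|i j|k' [f fP]] := @minimal_subdecomposition _ k (q \o r).
- by case: (qr i).
- by rewrite /= (qr i).2 (qr j).2 => /r_inj.
by exists k', (r \o f); split=> [i|]; [exists (f i)|rewrite bigcap_image].
Qed.

Lemma ass_primary_family D q : finite_set D ->
  (forall P, D P -> is_primary (q P) /\ radical (q P) = P) ->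
  ass (\bigcap_(P in D) q P) `<=` D.
Proof.
move=> finD qp P; have [k [r [rD [rdec _ _]]]] := minimal_primary_family finD
  qp.
by move=> /(ass_sub_radical rdec)[i ->]; rewrite (qp _ (rD i)).2.
Qed.

(** A minimal subdecomposition involves associated primes only, so the components at the other
    primes of [D] are redundant. *)
Lemma bigcap_ass_primary_family D q : finite_set D ->
  (forall P, D P -> is_primary (q P) /\ radical (q P) = P) ->
  \bigcap_(P in D) q P =
  \bigcap_(P in D `&` ass (\bigcap_(P in D) q P)) q P.
Proof.
move=> finD qp; have [k [r [rD rdec]]] := minimal_primary_family finD qp.
apply/seteqP; split=> x xq; first by move=> P [DP _]; apply: xq.
have [[_ ->] _ _] := rdec.
move=> i _; apply: (xq (r i)); split; first exact: rD.
by exists k, (q \o r); split=> //; exists i; rewrite /= (qp _ (rD i)).2.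
Qed.

End PrimaryFamily.

(** * Frobenius powers and f-sequences *)

Section Frobenius.
Variables (p : nat) (A : comNzRingType).
Hypothesis pcharA : p \in [pchar A].
Implicit Types (I J P Q b : set A) (x y z : A) (B K : nat -> set A).

Lemma pchar_expn_gt0 n : (0 < p ^ n)%N.
Proof. by rewrite expn_gt0 prime_gt0// (pcharf_prime pcharA). Qed.

Lemma frob_power_mono n I J : I `<=` J -> frob_power p n I `<=` frob_power p n
  J.
Proof.
move=> IJ; apply: smallest_sub; first exact: ideal_gen_is_ideal.
by move=> _ [x /IJ Jx <-]; apply: mem_ideal_gen; exists x.
Qed.

Lemma frob_power_sub n I : is_ideal I -> frob_power p n I `<=` I.
Proof.
move=> II; apply: smallest_sub => // _ [x Ix <-].
by apply: ideal_expr => //; apply: pchar_expn_gt0.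
Qed.

Lemma frob_power_step n I x : is_ideal I ->
  frob_power p n I x -> frob_power p n.+1 I (x ^+ p).
Proof.
move=> II xI; rewrite -addn1 -frob_powerD//.
by have := frob_power_expr (m := 1) xI; rewrite expn1.
Qed.

Lemma ideal_mul_expr I J I' J' :
  (forall x, I x -> I' (x ^+ p)) -> (forall x, J x -> J' (x ^+ p)) ->
  forall x, ideal_mul I J x -> ideal_mul I' J' (x ^+ p).
Proof.
move=> II' JJ' x.
have /(_ (ideal_gen_is_ideal _)) IF := preim_frob_ideal pcharA 1 (b :=
  ideal_mul I' J').
rewrite expn1 in IF; apply: (smallest_sub (X := [set x | ideal_mul I' J' (x ^+
  p)])) => //.
move=> _ [y [z [Iy Jz ->]]] /=; apply: mem_ideal_gen.
by exists (y ^+ p), (z ^+ p); rewrite exprMn; split=> //;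
  [apply: II'|apply: JJ'].
Qed.

Lemma ideal_pow_frob_step n h I x : is_ideal I ->
  ideal_pow (frob_power p n I) h x ->
  ideal_pow (frob_power p n.+1 I) h (x ^+ p).
Proof.
move=> II; elim: h x => //= h IHh x; apply: ideal_mul_expr => // y.
exact: frob_power_step.
Qed.

(** Frobenius is additive, so only the p^n-th powers of finitely many generators have to reach [J],
    and k < p^k supplies the exponents. *)
Lemma frob_power_radical I J : noetherian A -> is_ideal I -> is_ideal J ->
  I `<=` radical J -> exists N, forall n, (N <= n)%N -> frob_power p n I `<=` J.
Proof.
move=> noethA II IJ IJ'.
have p1 : (1 < p)%N by rewrite prime_gt1// (pcharf_prime pcharA).
have [s sE] := noethA _ II.
suff [N sN] : exists N, forall n, (N <= n)%N ->
    {in s, forall x, J (x ^+ (p ^ n))}.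
  exists N => n Nn; apply: smallest_sub => // _ [x + <-]; rewrite sE.
  apply: (smallest_sub (X := [set x | J (x ^+ (p ^ n))])).
    exact: preim_frob_ideal.
  by move=> y /= ys; apply: sN.
have {}IJ' : {in s, forall x, radical J x}.
  by move=> x xs; apply: IJ'; rewrite sE; apply: mem_ideal_gen.
elim: s IJ' {sE} => [|x s IHs] sJ; first by exists 0%N.
have [|N sN] := IHs; first by move=> y ys; apply: sJ; rewrite inE ys orbT.
have [k xk] := sJ x (mem_head _ _).
exists (maxn N k) => n; rewrite geq_max => /andP[Nn kn] y.
rewrite inE => /predU1P[->|]; last exact: sN.
by apply: ideal_exprW xk => //; apply: leq_trans kn (ltnW (ltn_expl _ p1)).
Qed.

(* Among the ideals J containing Ic and meeting Ac in Ic take a maximal one: it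
   contains a power of every element of I, hence some I^[p^n], hence c. *)
Lemma krull_frob_power I c m : noetherian A -> is_ideal I ->
  (forall n, (m <= n)%N -> frob_power p n I c) -> exists2 x, I x & c = x * c.
Proof.
move=> noethA II cI; have [I0 ID IM] := II.
pose Ic := [set x * c | x in I].
have IcI : is_ideal Ic.
  split=> [|_ _ [x Ix <-] [y Iy <-]|r _ [x Ix <-]].
  - by exists 0; rewrite ?mul0r.
  - by exists (x + y); [apply: ID|rewrite mulrDl].
  - by exists (r * x); [apply: IM|rewrite mulrA].
pose F := [set J | [/\ is_ideal J, Ic `<=` J & forall r, J (r * c) -> Ic (r *
  c)]].
have [J []//||J [IJ IcJ JIc] Jmax] := @noetherian_maximal _ noethA F.
  by exists Ic; split=> // y.
have [x xI|N NJ] := frob_power_radical noethA II IJ.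
  (* The colon ideals (J : x^k) ascend; a maximal one satisfies (J : x^(k+1)) = (J : x^k). *)
  pose G := [set K | exists k, K = [set y | J (x ^+ k * y)]].
  have [_ [k ->]||_ [k ->] Gmax] := @noetherian_maximal _ noethA G.
  - have [J0 JD JM] := IJ.
    split=> [|y z Jy Jz|r y Jy] /=; first by rewrite mulr0.
      by rewrite mulrDr; apply: JD.
    by rewrite mulrCA; apply: JM.
  - by exists [set y | J (x ^+ 0 * y)], 0%N.
  have colon y : J (x ^+ k.+1 * y) -> J (x ^+ k * y).
    apply: (Gmax [set y | J (x ^+ k.+1 * y)]); first by exists k.+1.
    by move=> z /=; rewrite exprS -mulrA; have [_ _] := IJ; apply.
  (* Maximality puts x^k into J once J + (x^k) is in [F]. If rc = j + t x^k, then xrc lies in Ic, so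
     t x^(k+1) lies in J; by the choice of k so do t x^k and rc. *)
  exists k; apply: (Jmax (ideal_add J [set x ^+ k])).
  - split; first exact: ideal_gen_is_ideal.
      by move=> y /IcJ Jy; apply: mem_ideal_gen; left.
    move=> r; rewrite ideal_adjoinP// => -[j [t [Jj rE]]].
    apply: JIc; rewrite rE; have [_ JD _] := IJ; apply: (JD) => //.
    rewrite mulrC; apply: colon; rewrite exprS -mulrA (mulrC _ t).
    rewrite -(addKr j (t * x ^+ k)) -rE mulrDr.
    apply: JD; first by rewrite mulrN; apply: ideal_opp => //;
      have [_ _] := IJ; apply.
    by apply: IcJ; exists (x * r); rewrite ?mulrA// mulrC; apply: IM.
  - by move=> y Jy; apply: mem_ideal_gen; left.
  - by apply: mem_ideal_gen; right.
have [|x Ix xc] := JIc 1; last by exists x => //; rewrite xc mul1r.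
rewrite mul1r; apply: (NJ (maxn m N)); first exact: leq_maxr.
by apply: cI; apply: leq_maxl.
Qed.

(** Otherwise Krull's intersection argument gives (1 - x)c = 0 with x in P. A minimal prime inside P
    cannot contain 1 - x, so it contains c. *)
Lemma circ_not_frob_power P c m : noetherian A -> is_prime P -> circ c ->
  ~ forall n, (m <= n)%N -> frob_power p n P c.
Proof.
move=> noethA pP cc cP; have [[IP P1] _] := pP.
have [x Px cE] := krull_frob_power noethA IP cP.
have [_ [_ /(_ _ pP)[Q mQ QP] _]] := noetherian_minimal_primes noethA.
apply: cc; exists Q => //; have [[[[Q0 _ _] _] QM] _] := mQ.
have /QM[] : Q ((1 - x) * c) by rewrite mulrBl mul1r -cE subrr.
  move=> /QP Px1; case: P1; rewrite -(subrK x 1); have [_ PD _] := IP.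
  exact: PD.
by [].
Qed.

Lemma f_sequence_expr B n m x :
  f_sequence p B -> B (n + m)%N (x ^+ (p ^ m)) <-> B n x.
Proof.
move=> fb; elim: m x => [|m IHm] x; first by rewrite addn0 expr1.
rewrite -IHm addnS -(fb (n + m)%N).2 /= -exprM -expnSr.
by [].
Qed.

Definition f_primary P B : Prop :=
  f_sequence p B /\ forall n, is_primary (B n) /\ radical (B n) = P.

(* In the perfect closure this is the contraction of the localization at P of
   the ideal generated by all the psi_n (K n). *)
Definition frob_component K P n : set A :=
  [set r | exists j s, ~ P s /\ K (n + j)%N (s * r ^+ (p ^ j))].

Section Component.
Variables (K : nat -> set A) (P : set A).
Hypotheses (idealI : forall n, is_ideal (K n))
  (stepI : forall n x, K n x -> K n.+1 (x ^+ p))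
  (primeP : is_prime P) (subP : forall n, K n `<=` P)
  (radP : forall n, P `<=` radical (K n)).

Lemma sub_frob_component n : K n `<=` frob_component K P n.
Proof.
move=> x Ix; have [[_ P1] _] := primeP.
by exists 0%N, 1; rewrite addn0 mul1r expr1.
Qed.

Lemma frob_component_lift n j k s r : ~ P s -> K (n + j)%N (s * r ^+ (p ^ j)) ->
  (j <= k)%N -> exists2 t, ~ P t & K (n + k)%N (t * r ^+ (p ^ k)).
Proof.
move=> Ps sI /subnKC <-; elim: (k - j)%N => [|i [t Pt tI]].
  by exists s; rewrite // addn0.
exists (t ^+ p); first by move/(prime_expr primeP).
by rewrite !addnS expnSr exprM -exprMn; apply: stepI.
Qed.

Lemma frob_component_f_sequence : f_sequence p (frob_component K P).
Proof.
have [_ PM] := primeP.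
move=> n; split; first split.
- by apply: sub_frob_component; have [] := idealI n.
- move=> x y [j [s [Ps sI]]] [k [t [Pt tI]]].
  have [s' Ps' sI'] := frob_component_lift Ps sI (leq_maxl j k).
  have [t' Pt' tI'] := frob_component_lift Pt tI (leq_maxr j k).
  exists (maxn j k), (s' * t'); split; first by move/PM => [].
  have [_ ID IM] := idealI (n + maxn j k).
  rewrite expr_frobD// mulrDr; apply: ID; last by rewrite -mulrA; apply: IM.
  by rewrite mulrAC; apply: ideal_mulr.
- move=> r x [j [s [Ps sI]]]; exists j, s; split=> //.
  by rewrite exprMn mulrCA; have [_ _] := idealI (n + j); apply.
apply/seteqP; split=> x [j [s [Ps sI]]].
  by exists j.+1, s; rewrite addnS -addSn expnS exprM.
exists j, (s ^+ p); split; first by move/(prime_expr primeP).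
by rewrite addSn -exprM mulnC exprM -exprMn; apply: stepI.
Qed.

(** For xy in a component and y outside P, the factor y^(p^j) is absorbed into the multiplier [s].
    The radical is P because the component lies in P and [K n] contains a power of each element of
    P. *)
Lemma frob_component_primary : f_primary P (frob_component K P).
Proof.
have [[_ P1] PM] := primeP.
split=> [|n]; first exact: frob_component_f_sequence.
have CP : frob_component K P n `<=` P.
  by move=> x [j [s [Ps /subP/PM[//|/(prime_expr primeP)]]]].
have [CI _] := frob_component_f_sequence n.
have radC : radical (frob_component K P n) = P.
  apply/seteqP; split; first exact: prime_radical.
  by move=> x /(radP n)[k xk]; exists k; apply: sub_frob_component.
split=> //; split; first by split=> // /CP.
move=> x y [j [s [Ps sI]]]; rewrite radC; have [|Py] := pselect (P y);
  first by right.
left; exists j, (s * y ^+ (p ^ j)); split.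
  by move/PM => [//|/(prime_expr primeP)].
by rewrite -mulrA -exprMn (mulrC y).
Qed.

End Component.

End Frobenius.

(** * The perfect closure *)

Section SubringQuotient.
Variable R : comNzRingType.

Lemma subring_rmorphism (S : set R) : S 1 ->
  (forall x y, S x -> S y -> S (x - y)) ->
  (forall x y, S x -> S y -> S (x * y)) ->
  exists (T : comNzRingType) (i : {rmorphism T -> R}), injective i /\ range i =
    S.
Proof.
move=> S1 SB SM; pose s : {pred R} := fun x => `[< S x >].
have sP : subring_closed s.
  by split=> [|x y|x y]; rewrite !unfold_in; first exact/asboolP;
    move=> /asboolP Sx /asboolP Sy; apply/asboolP; [apply: SB|apply: SM].
pose sc : subringClosed R := HB.pack s (GRing.isSubringClosed.Build R s sP).
pose T0 := {x : R | x \in sc}.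
pose m := [SubChoice_isSubComNzRing of T0 by <:].
pose T : subComNzRingType (fun x => x \in sc) := HB.pack T0 m.
exists T, (\val : {rmorphism T -> R}).
split; first exact: val_inj.
apply/seteqP; split=> [_ [x _ <-]|x Sx].
  by apply/asboolP; have := valP x.
have sx : x \in sc by apply/asboolP.
by exists (Sub x sx) => //; rewrite SubK.
Qed.

Lemma quotient_rmorphism (J : set R) : proper_id J ->
  exists (T : comNzRingType) (f : {rmorphism R -> T}),
    range f = setT /\ forall x, f x = 0 <-> J x.
Proof.
move=> [IJ J1]; have [J0 JD JM] := IJ; pose j : {pred R} := fun x => `[< J x >].
have jP : idealr_closed j.
  split=> [||a x y]; rewrite !unfold_in; first exact/asboolP.
    exact/asboolP.
  by move=> /asboolP Jx /asboolP Jy; apply/asboolP; apply: JD => //; apply: JM.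
pose jc : idealr R := HB.pack j (isIdealr.Build R j jP).
exists {ideal_quot jc}, (\pi_({ideal_quot jc})%qT : {rmorphism R -> {ideal_quot
  jc}}).
split=> [|x].
  by apply/seteqP; split=> // y _; exists (repr y) => //; exact: reprK.
have := Quotient.idealrBE jc x 0; rewrite subr0 => jE.
rewrite -(rmorph0 (\pi_({ideal_quot jc})%qT : {rmorphism R -> {ideal_quot
  jc}})).
split=> [/eqP|Jx].
  by rewrite -jE => /asboolP.
by apply/eqP; rewrite -jE; apply/asboolP.
Qed.

End SubringQuotient.

Lemma lift_rmorphism (R S T : comNzRingType) (i : {rmorphism T -> S})
    (g : {rmorphism R -> S}) : injective i -> range g `<=` range i ->
  exists k : {rmorphism R -> T}, forall x, i (k x) = g x.
Proof.
move=> i_inj gi.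
have /choice[k kP] : forall x, exists y, i y = g x.
  by move=> x; have [|y _ <-] := gi (g x); [exists x|exists y].
have kB : zmod_morphism k by move=> x y; apply: i_inj;
  rewrite rmorphB !kP rmorphB.
have kM : monoid_morphism k.
  by split=> [|x y]; apply: i_inj; rewrite ?rmorph1 ?rmorphM !kP ?rmorph1
    ?rmorphM.
pose k' : {rmorphism R -> T} := HB.pack k
  (GRing.isZmodMorphism.Build R T k kB) (GRing.isMonoidMorphism.Build R T k kM).
by exists k'.
Qed.

Lemma expr_frobB p (T : comNzRingType) n (x y : T) : p \in [pchar T] ->
  (x - y) ^+ (p ^ n) = x ^+ (p ^ n) - y ^+ (p ^ n).
Proof. by move=> pT; rewrite -[in RHS](subrK y x) [in RHS]expr_frobD// addrK.
  Qed.

Lemma surjective_injective_perfect p (T : comNzRingType) : p \in [pchar T] ->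
  (forall x : T, x ^+ p = 0 -> x = 0) -> (forall x : T, exists y, y ^+ p = x) ->
  perfect p T.
Proof.
move=> pT inj0 surj; split=> //.
have inj (x y : T) : x ^+ p = y ^+ p -> x = y.
  move=> xy; apply/eqP; rewrite -subr_eq0; apply/eqP/inj0.
  by have := expr_frobB 1 x y pT; rewrite expn1 xy subrr.
have /choice[h hK] := surj.
by exists h => x; [apply: inj|]; rewrite hK.
Qed.

Section PerfectHull.
Variables (p : nat) (R : comNzRingType).
Hypothesis pcharR : p \in [pchar R].

(* The hull is realized by the sequences u with u_(n+1) = u_n^p for large n,
   modulo those that are eventually zero: up to this, Frobenius is the shift. *)
Lemma perfect_hull : exists (T : comNzRingType) (g : {rmorphism R -> T}),
  perfect p T /\ forall r, g r = 0 -> exists n, r ^+ (p ^ n) = 0.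
Proof.
have p0 : (0 < p)%N by rewrite prime_gt0// (pcharf_prime pcharR).
pose S := [set u : nat -> R |
  exists N, forall n, (N <= n)%N -> u n.+1 = u n ^+ p].
have expB x y : (x - y) ^+ p = x ^+ p - y ^+ p :> R.
  by have := expr_frobB 1 x y pcharR; rewrite expn1.
have [|u v [N uN] [M vM]|u v [N uN] [M vM]|T1 [i [i_inj iS]]] :=
    @subring_rmorphism _ S.
- by exists 0%N => n _; rewrite /= expr1n.
- exists (maxn N M) => n; rewrite geq_max => /andP[Nn Mn].
  by rewrite addrfctE opprfctE uN// vM// expB.
- exists (maxn N M) => n; rewrite geq_max => /andP[Nn Mn].
  by rewrite !mulrfctE uN// vM// exprMn.
pose J := [set t : T1 | exists N, forall n, (N <= n)%N -> i t n = 0].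
have [|T [f [f_surj f0]]] := @quotient_rmorphism _ J.
  split; first split.
  - by exists 0%N => n _; rewrite rmorph0.
  - move=> x y [N xN] [M yM]; exists (maxn N M) => n.
    rewrite geq_max => /andP[Nn Mn].
    by rewrite rmorphD addrfctE xN// yM// addr0.
  - move=> r x [N xN]; exists N => n Nn.
    by rewrite rmorphM mulrfctE xN// mulr0.
  - case=> N /(_ N (leqnn N)); rewrite rmorph1.
    by move/eqP; rewrite [X in X == _]/(1 : R) oner_eq0.
pose pw (r : R) (n : nat) := r ^+ (p ^ n).
have pwB : zmod_morphism pw.
  by move=> x y; apply/funext => n; apply: expr_frobB.
have pwM : monoid_morphism pw.
  by split=> [|x y]; apply/funext => n; rewrite /pw ?expr1n ?exprMn.
pose pw' : {rmorphism R -> (nat -> R)} := HB.pack pw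
  (GRing.isZmodMorphism.Build _ _ pw pwB) (GRing.isMonoidMorphism.Build _ _ pw
    pwM).
have [|k kP] := lift_rmorphism (g := pw') i_inj.
  move=> _ [r _ <-]; rewrite iS; exists 0%N => n _.
  by rewrite /= /pw expnSr exprM.
exists T, (f \o k); split; last first.
  move=> r /f0[N /(_ N (leqnn N))]; rewrite kP.
  by exists N.
apply: surjective_injective_perfect => [||x].
- exact: (rmorph_pchar (f \o k : {rmorphism R -> T})).
- move=> x; have [t _ <-] : range f x by rewrite f_surj.
  rewrite -rmorphXn => /f0[N tN]; apply/f0.
  have : range i (i t) by exists t.
  (* Past M each term is the p-th power of its predecessor, so t vanishes one index after t^p
     does. *)
  rewrite iS => -[M tM]; exists (maxn N M).+1 => -[//|n].
  rewrite ltnS geq_max => /andP[Nn Mn]; rewrite tM//.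
  by have := tN n Nn; rewrite rmorphXn exprfctE.
have [t _ <-] : range f x by rewrite f_surj.
have : range i (i t) by exists t.
rewrite iS => -[M tM].
(* The p-th root is t delayed by one index; the 0 in front is immaterial modulo [J]. *)
have : range i (fun n => if n is m.+1 then i t m else 0).
  by rewrite iS; exists M.+1 => -[//|n] /tM.
case=> u _ uE; exists (f u); apply/eqP; rewrite -subr_eq0 -rmorphXn -rmorphB.
apply/eqP/f0; exists M.+1 => -[//|n] /tM tn.
by rewrite rmorphB rmorphXn uE addrfctE opprfctE exprfctE tn subrr.
Qed.

End PerfectHull.

Section PerfectClosure.
Variables (p : nat) (R Rinf : comNzRingType) (psi0 : {rmorphism R -> Rinf}).
Hypotheses (pcharR : p \in [pchar R]) (perfR : perfect_closure p psi0).

(** Universality maps [Rinf] to the perfect hull compatibly with [R], and in the hull only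
    nilpotents of [R] vanish. *)
Lemma perfect_closure_ker r : psi0 r = 0 -> exists n, r ^+ (p ^ n) = 0.
Proof.
have [T [g [perfT gker]]] := perfect_hull pcharR.
have [h [hE _]] := perfR.2 _ perfT g.
by move=> r0; apply: gker; rewrite -hE /= r0 rmorph0.
Qed.

Lemma perfect_expr_inj n (x y : Rinf) : x ^+ (p ^ n) = y ^+ (p ^ n) -> x = y.
Proof.
have [[_ /bij_inj inj] _] := perfR.
by elim: n => [|n IHn]; rewrite ?expr1// expnSr !exprM => /inj.
Qed.

Lemma perfect_expr_surj n (y : Rinf) : exists x, x ^+ (p ^ n) = y.
Proof.
have [[_ [h _ hK]] _] := perfR.
elim: n y => [|n IHn] y; first by exists y; rewrite expr1.
by have [x xE] := IHn (h y); exists x; rewrite expnSr exprM xE hK.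
Qed.

(* The x having a power in the image of psi0 form a perfect subring, which is
   everything by universality. *)
Lemma perfect_closure_expr (x : Rinf) : exists n r, x ^+ (p ^ n) = psi0 r.
Proof.
have [[pRinf _] _] := perfR.
pose S := [set x : Rinf | exists n r, x ^+ (p ^ n) = psi0 r].
have common a b (y z : Rinf) n m : y ^+ (p ^ n) = psi0 a -> z ^+ (p ^ m) = psi0
  b ->
    y ^+ (p ^ (n + m)) = psi0 (a ^+ (p ^ m)) /\ z ^+ (p ^ (n + m)) = psi0 (b ^+
      (p ^ n)).
  by rewrite expnD exprM mulnC exprM => -> ->; rewrite !rmorphXn.
have [|y z [n [a ya]] [m [b zb]]|y z [n [a ya]] [m [b zb]]|T [i [i_inj iS]]] :=
    @subring_rmorphism _ S.
- by exists 0%N, 1; rewrite expr1 rmorph1.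
- have [yE zE] := common _ _ _ _ _ _ ya zb.
  exists (n + m)%N, (a ^+ (p ^ m) - b ^+ (p ^ n)).
  by rewrite expr_frobB// yE zE rmorphB.
- have [yE zE] := common _ _ _ _ _ _ ya zb.
  exists (n + m)%N, (a ^+ (p ^ m) * b ^+ (p ^ n)).
  by rewrite exprMn yE zE rmorphM.
have pT : p \in [pchar T].
  apply/andP; split; first exact: pcharf_prime pRinf.
  apply/eqP/i_inj; rewrite rmorph_nat rmorph0; exact: pcharf0 pRinf.
have perfT : perfect p T.
  apply: surjective_injective_perfect => // t.
    move=> t0; apply: i_inj; apply: (@perfect_expr_inj 1).
    by rewrite expn1 -rmorphXn t0 rmorph0 expr0n; case: p pT.
  have [y yE] := perfect_expr_surj 1 (i t).
  have : range i (i t) by exists t.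
  rewrite iS => -[n [r tr]].
  have : range i y.
    by rewrite iS; exists n.+1, r; rewrite expnS exprM -[p in y ^+ p]expn1 yE.
  by case=> u _ uE; exists u; apply: i_inj; rewrite rmorphXn uE -yE expn1.
have [|k kP] := lift_rmorphism (g := psi0) i_inj.
  by move=> _ [r _ <-]; rewrite iS; exists 0%N, r; rewrite expr1.
(* Both [i \o h] and the identity are endomorphisms of [Rinf] extending [psi0]; uniqueness equates
   them, so [i] is onto. *)
have [h [hE _]] := perfR.2 _ perfT k.
have [h' [_ uniq]] := perfR.2 _ perfR.1 psi0.
have id_h' : idfun x = h' x by apply: (uniq idfun).
have ih_h' : i (h x) = h' x.
  by apply: (uniq (i \o h)) => r; rewrite -[RHS]kP -hE.
have : range i x by rewrite -[x]/(idfun x) id_h' -ih_h'; exists (h x).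
by rewrite iS.
Qed.

End PerfectClosure.

(** * Ideals of the perfect closure attached to f-sequences *)

Section FSequenceIdeal.
Variables (p : nat) (R Rinf : comNzRingType) (psi0 : {rmorphism R -> Rinf}).
Hypotheses (pcharR : p \in [pchar R]) (perfR : perfect_closure p psi0).
Implicit Types (x y : Rinf) (r s : R) (B : nat -> set R).

Let pcharRinf : p \in [pchar Rinf]. Proof. by case: perfR => -[]. Qed.

Lemma psi_expr n r : psi p psi0 n r ^+ (p ^ n) = psi0 r.
Proof. exact: xgetPex (perfect_expr_surj perfR n (psi0 r)). Qed.

Lemma expr_psi x n r : x ^+ (p ^ n) = psi0 r -> x = psi p psi0 n r.
Proof.
by move=> xr; apply: (perfect_expr_inj perfR (n := n)); rewrite psi_expr.
Qed.

Lemma expr_lift x n m r :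
  x ^+ (p ^ n) = psi0 r -> x ^+ (p ^ (n + m)) = psi0 (r ^+ (p ^ m)).
Proof. by rewrite expnD exprM rmorphXn => ->. Qed.

Lemma common_expr x y : exists n r s,
  x ^+ (p ^ n) = psi0 r /\ y ^+ (p ^ n) = psi0 s.
Proof.
have [n [r xr]] := perfect_closure_expr perfR x.
have [m [s ys]] := perfect_closure_expr perfR y.
exists (n + m)%N, (r ^+ (p ^ m)), (s ^+ (p ^ n)).
by rewrite {2}addnC (expr_lift m xr) (expr_lift n ys).
Qed.

(** Two representations of x as a root agree after a further Frobenius power, the kernel of [psi0]
    being nilpotent, and such powers do not affect membership in an f-sequence. Hence any one
    representation decides membership. *)
Lemma fseq_idealE B x n r : f_sequence p B -> x ^+ (p ^ n) = psi0 r ->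
  fseq_ideal p psi0 B x <-> B n r.
Proof.
move=> fB xr; split=> [[m _ [s Bs sx]]|Br]; last first.
  by exists n => //; exists r => //; rewrite (expr_psi xr).
have ys := psi_expr m s; rewrite sx in ys.
have [|k] := perfect_closure_ker pcharR perfR (r := r ^+ (p ^ m) - s ^+ (p ^
  n)).
  by rewrite rmorphB -(expr_lift m xr) -(expr_lift n ys) addnC subrr.
rewrite expr_frobB// => /subr0_eq; rewrite -!exprM -!expnD => rs.
by rewrite -(f_sequence_expr _ (m + k) _ fB) rs addnCA f_sequence_expr.
Qed.

Lemma fseq_ideal_bigcap (D : set (set R)) (B : set R -> nat -> set R) :
  (forall P, D P -> f_sequence p (B P)) ->
  fseq_ideal p psi0 (fun n => \bigcap_(P in D) B P n) =
  \bigcap_(P in D) fseq_ideal p psi0 (B P).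
Proof.
move=> fB; apply/seteqP; split=> x.
  by move=> [n _ [r Br <-]] P DP; exists n => //; exists r => //; apply: Br.
have [n [r xr]] := perfect_closure_expr perfR x.
move=> xB; exists n => //; exists r; last by rewrite (expr_psi xr).
by move=> P DP; apply: (fseq_idealE (fB P DP) xr).1; apply: xB.
Qed.

Lemma fseq_ideal_is_ideal B : f_sequence p B -> is_ideal (fseq_ideal p psi0 B).
Proof.
move=> fB; split=> [|x y|x y].
- by apply/(fseq_idealE (n := 0) (r := 0) fB); rewrite ?rmorph0 ?expr1//;
    have [[]] := fB 0%N.
- have [n [r [s [xr ys]]]] := common_expr x y.
  move=> /(fseq_idealE fB xr) Br /(fseq_idealE fB ys) Bs.
  apply/(fseq_idealE (n := n) (r := r + s) fB).
    by rewrite expr_frobD// xr ys rmorphD.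
  by have [[_ BD _] _] := fB n; apply: BD.
have [n [r [s [xr ys]]]] := common_expr x y.
move=> /(fseq_idealE fB ys) Bs.
apply/(fseq_idealE (n := n) (r := r * s) fB).
  by rewrite exprMn xr ys rmorphM.
by have [[_ _ BM] _] := fB n; apply: BM.
Qed.

Lemma fseq_ideal_primary B : f_sequence p B -> (forall n, is_primary (B n)) ->
  is_primary (fseq_ideal p psi0 B).
Proof.
move=> fB pB; split; first split; first exact: fseq_ideal_is_ideal.
  have [[_ B1] _] := pB 0%N.
  move=> /(fseq_idealE (n := 0) (r := 1) fB) => -/(_ _)/B1.
  by rewrite expr1 rmorph1; apply.
move=> x y; have [n [r [s [xr ys]]]] := common_expr x y.
have xyr : (x * y) ^+ (p ^ n) = psi0 (r * s) by rewrite exprMn xr ys rmorphM.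
move=> /(fseq_idealE fB xyr); have [_ BM] := pB n.
case/BM => [Br|[k Bk]]; [left|right; exists k]; first exact/(fseq_idealE fB xr).
by apply/(fseq_idealE (n := n) (r := s ^+ k) fB); rewrite // exprAC ys rmorphXn.
Qed.

(** In a perfect ring the p^n-th powers of the elements of [I] already form an ideal, every
    multiplier being a p^n-th power itself; roots are unique. *)
Lemma frob_power_root n (I : set Rinf) x : is_ideal I ->
  frob_power p n I (x ^+ (p ^ n)) -> I x.
Proof.
move=> II; have [I0 ID IM] := II.
suff /(_ (x ^+ (p ^ n))) : frob_power p n I `<=` [set y ^+ (p ^ n) | y in I].
  by move=> /[apply] -[y Iy /(perfect_expr_inj perfR) <-].
apply: smallest_sub => //; split.
- by exists 0; rewrite // expr0n expn_eq0; case: p pcharRinf.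
- by move=> _ _ [y Iy <-] [z Iz <-]; exists (y + z); rewrite ?expr_frobD//;
  apply: ID.
move=> u _ [y Iy <-]; have [v <-] := perfect_expr_surj perfR n u.
by exists (v * y); rewrite ?exprMn//; apply: IM.
Qed.

Lemma extension_frob_power n (a : set R) r :
  frob_power p n a r -> frob_power p n (extension psi0 a) (psi0 r).
Proof.
apply: (smallest_sub (X := [set r | frob_power p n (extension psi0 a) (psi0
  r)])).
  have [F0 FD FM] := ideal_gen_is_ideal
    [set x ^+ (p ^ n) | x in extension psi0 a].
  split=> [|y z yF zF|y z zF] /=; rewrite ?rmorph0 ?rmorphD ?rmorphM//.
    exact: FD.
  exact: FM.
move=> _ [y ay <-] /=; rewrite rmorphXn; apply: mem_ideal_gen.
by exists (psi0 y) => //; apply: mem_ideal_gen; exists y.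
Qed.

Lemma fseq_ideal_frob_closure a : is_ideal a ->
  fseq_ideal p psi0 (fun n => frob_closure p (frob_power p n a)) =
  extension psi0 a.
Proof.
move=> Ia; have fa := frob_closure_f_sequence pcharR Ia.
apply/seteqP; split.
  move=> _ [n _ [r [m ram] <-]]; rewrite frob_powerD// in ram.
  apply: (@frob_power_root (n + m)); first exact: ideal_gen_is_ideal.
  by rewrite (expr_lift m (psi_expr n r)); apply: extension_frob_power.
apply: smallest_sub; first exact: fseq_ideal_is_ideal.
move=> _ [r ar <-]; apply/(fseq_idealE (n := 0) (r := r) fa);
  first by rewrite expr1.
by exists 0%N; rewrite frob_powerD//; apply: mem_ideal_gen; exists r.
Qed.

Lemma has_primary_decomposition_fseq (D : set (set R)) (B : set R -> nat -> set
  R) :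
  finite_set D -> (forall P, D P -> f_primary p P (B P)) ->
  has_primary_decomposition
    (fseq_ideal p psi0 (fun n => \bigcap_(P in D) B P n)).
Proof.
move=> finD fB; rewrite fseq_ideal_bigcap => [|P /fB[]//].
apply: (has_primary_decomposition_family
  (q := fun P => fseq_ideal p psi0 (B P))) => // P /fB[fP pP].
by apply: fseq_ideal_primary => // n; case: (pP n).
Qed.

End FSequenceIdeal.

(** At each n, dropping redundant components gives a minimal decomposition whose remaining
    components satisfy the bound with the same [h]. *)
Lemma linear_growth_family p (R : comNzRingType) h (D : set (set R))
    (B : set R -> nat -> set R) : finite_set D ->
  (forall P, D P -> f_primary p P (B P)) -> (0 < h)%N ->
  (forall P n, D P -> ideal_pow (frob_power p n P) h `<=` B P n) ->
  (forall n, ~ (\bigcap_(P in D) B P n) 1) ->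
  linear_growth p (fun n => \bigcap_(P in D) B P n).
Proof.
move=> finD fB h0 hB B1; split=> [n|].
  by split=> //; apply: ideal_bigcap => P /fB[/(_ n)[]].
exists h; split=> // n.
have pB P : D P -> is_primary (B P n) /\ radical (B P n) = P.
  by move=> /fB[_ /(_ n)].
have [k [r [rD rdec]]] := minimal_primary_family finD pB.
exists k, (fun i => B (r i) n); split=> // i.
by rewrite (pB _ (rD i)).2; apply: hB.
Qed.

(** * Tight closure and localization *)

Section TightClosure.
Variables (p : nat) (R : comNzRingType).
Hypothesis pcharR : p \in [pchar R].
Implicit Types (a b P : set R) (r c d : R) (B : nat -> set R).

Lemma sub_frob_closure b : is_ideal b -> b `<=` frob_closure p b.
Proof. by move=> Ib x bx; exists 0%N; apply: mem_ideal_gen; exists x. Qed.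

Lemma frob_closure_sub_tight b : is_ideal b ->
  frob_closure p b `<=` tight_closure p b.
Proof.
move=> Ib r [k rk]; exists 1; first exact: circ1.
exists k => n /subnKC <-; rewrite mul1r expnD exprM -frob_powerD//.
exact: frob_power_expr.
Qed.

Lemma tight_closure_proper a P : noetherian R -> is_prime P -> a `<=` P ->
  ~ tight_closure p a 1.
Proof.
move=> noethR pP aP [c cc [N cN]]; apply: (@circ_not_frob_power p _ pcharR P c
  N) => //.
by move=> n /cN; rewrite expr1n mulr1; apply: frob_power_mono.
Qed.

(** The F-closure lies in the tight closure, so the test element clears it at the fixed exponent
    p^m0; thus c d^(p^m0) is a single multiplier for all large n. *)
Lemma frob_closure_tight_closure m0 c d N a r :
  weak_test_element p m0 c -> is_ideal a -> circ d ->
  (forall n, (N <= n)%N ->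
     frob_closure p (frob_power p n a) (d * r ^+ (p ^ n))) ->
  tight_closure p a r.
Proof.
move=> [cc ctest] Ia cd dr; exists (c * d ^+ (p ^ m0)).
  by apply: circM => //; elim: (p ^ m0)%N => [|k IHk];
    rewrite ?exprS; [exact: circ1|exact: circM].
exists (N + m0)%N => n Nn.
have m0n : (m0 <= n)%N := leq_trans (leq_addl _ _) Nn.
have IF : is_ideal (frob_power p (n - m0) a) by apply: ideal_gen_is_ideal.
have Nn0 : (N <= n - m0)%N by rewrite leq_subRL// addnC.
have /(ctest _ IF) /(_ m0 (leqnn _)) := frob_closure_sub_tight IF (dr _ Nn0).
by rewrite frob_powerD// subnK// exprMn -exprM -expnD subnK// mulrA.
Qed.

Definition test_component c B n : set R :=
  [set r | forall m, B (n + m)%N (c * r ^+ (p ^ m))].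

Lemma sub_test_component c B n : f_sequence p B ->
  B n `<=` test_component c B n.
Proof.
move=> fB r Br m; have [[_ _ BM] _] := fB (n + m)%N.
by apply/BM/f_sequence_expr.
Qed.

Lemma test_component_f_sequence c B : f_sequence p B ->
  f_sequence p (test_component c B).
Proof.
move=> fB n; split; first split=> [|x y xT yT|x y yT] m.
- have [[B0 _ _] _] := fB (n + m)%N.
  by rewrite expr0n expn_eq0 eqn0Ngt prime_gt0 ?mulr0// (pcharf_prime pcharR).
- have [[_ BD _] _] := fB (n + m)%N.
  by rewrite expr_frobD// mulrDr; apply: BD.
- have [[_ _ BM] _] := fB (n + m)%N.
  by rewrite exprMn mulrCA; apply: BM.
apply/seteqP; split=> x xT m.
  (* The p-th power of c x^(p^m) carries c^p where the hypothesis has c; the ideal absorbs the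
     surplus c^(p-1). *)
  apply/(f_sequence_expr (n + m) 1 _ fB); rewrite expn1 exprMn -exprM -expnSr.
  have -> : c ^+ p = c ^+ p.-1 * c.
    by rewrite -exprSr prednK// prime_gt0// (pcharf_prime pcharR).
  have [[_ _ BM] _] := fB (n + m + 1)%N.
  rewrite -mulrA; apply: BM; have := xT m.
  by rewrite /= -exprM -expnS addn1 addSn.
by rewrite /= -exprM -expnS addSn -addnS; apply: xT.
Qed.

(** Properness passes from level 0 to all levels because 1 is its own p^n-th power. For xy in the
    component and y outside P, the factor y^(p^m) cancels modulo the P-primary ideal [B (n + m)]. *)
Lemma test_component_primary c P B : f_primary p P B ->
  ~ test_component c B 0 1 -> f_primary p P (test_component c B).
Proof.
move=> [fB pB] T1; have fT := test_component_f_sequence c fB.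
split=> // n.
have T1n : ~ test_component c B n 1.
  have := f_sequence_expr 0 n 1 fT; rewrite expr1n add0n.
  by move=> E /E.
have TM x y : test_component c B n (x * y) -> test_component c B n x \/ P y.
  move=> xyT; have [|Py] := pselect (P y); first by right.
  left=> m; have [pBm rB] := pB (n + m)%N.
  have /pBm.2[//|] : B (n + m)%N (c * x ^+ (p ^ m) * y ^+ (p ^ m)).
    by rewrite -mulrA -exprMn.
  rewrite rB => /prime_expr; case/(_ _)/Py.
  by rewrite -rB; apply: radical_primary_prime.
have rT : radical (test_component c B n) = P.
  have pP : is_prime P by rewrite -(pB n).2;
    apply: radical_primary_prime (pB n).1.
  apply/seteqP; split.
    by apply: prime_radical => // x; rewrite -{1}(mul1r x) => /TM[].
  by rewrite -(pB n).2 => x [k xk]; exists k; apply: sub_test_component.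
split=> //; split; first by split=> //; case: (fT n).
by rewrite rT.
Qed.

End TightClosure.

(** * Rings of fractions: extended ideals, minimal primes and multipliers *)

Section Localization.
Variables (R B : comPzRingType) (S : set R) (phi : {rmorphism R -> B}).
Hypotheses (multS : mult_closed S) (locS : localization S phi).
Implicit Types (I P : set R) (x y : B) (r s : R).

Lemma mult_closed_expr s n : S s -> S (s ^+ n).
Proof.
have [S1 SM] := multS.
move=> Ss; elim: n => [//|n IHn]; rewrite exprS; exact: SM.
Qed.

Lemma mult_closed_prod (T : eqType) (q : seq T) (F : T -> R) :
  (forall i, S (F i)) -> S (\prod_(i <- q) F i).
Proof. by move=> SF; have [S1 SM] := multS; apply: (big_ind S). Qed.

Lemma localization_eq r r' : phi r = phi r' -> exists2 s, S s & s * r = s * r'.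
Proof.
have [_ _ ker] := locS.
move=> rr'; have /ker[s [Ss srr']] : phi (r - r') = 0 by rewrite rmorphB rr'
  subrr.
by exists s => //; apply/eqP; rewrite -subr_eq0 -mulrBr srr'.
Qed.

Lemma localization_extension I : is_ideal I ->
  extension phi I = [set x | exists s r, [/\ S s, I r & x * phi s = phi r]].
Proof.
move=> II; have [I0 ID IM] := II; have [unit frac _] := locS.
have [S1 SM] := multS.
apply/seteqP; split.
  apply: smallest_sub; first split.
  - by exists 1, 0; rewrite mul0r rmorph0.
  - move=> x y [s [r [Ss Ir xs]]] [t [u [St Iu yt]]];
    exists (s * t), (r * t + u * s).
    split; [exact: SM|by apply: ID; apply: ideal_mulr|].
    rewrite mulrDl !rmorphM mulrA xs (mulrC (phi s)) mulrA yt.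
    by rewrite rmorphD !rmorphM.
  - move=> b y [t [u [St Iu yt]]]; have [r [s [Ss bs]]] := frac b.
    exists (s * t), (r * u); split; [exact: SM|exact: IM|].
    by rewrite !rmorphM mulrACA bs yt.
  by move=> _ [r Ir <-]; exists 1, r; rewrite rmorph1 mulr1.
move=> x [s [r [Ss Ir xs]]]; have [u su] := unit s Ss.
have IE : is_ideal (extension phi I) by apply: ideal_gen_is_ideal.
rewrite -(mulr1 x) -su mulrA xs; apply: (ideal_mulr _ IE).
by apply: mem_ideal_gen; exists r.
Qed.

Lemma localization_extension_phi I r : is_ideal I ->
  extension phi I (phi r) -> exists2 s, S s & I (s * r).
Proof.
move=> II; rewrite localization_extension// => -[s [t [Ss It]]].
rewrite -rmorphM => /localization_eq[u Su urs]; exists (u * s).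
  by have [_ SM] := multS; apply: SM.
by rewrite -mulrA (mulrC s) urs; have [_ _] := II; apply.
Qed.

Lemma localization_preim_prime (Q : set B) : is_prime Q ->
  is_prime (phi @^-1` Q) /\ forall s, S s -> ~ Q (phi s).
Proof.
move=> [[[Q0 QD QM] Q1] QP]; have [unit _ _] := locS.
split; last first.
  by move=> s /unit[u su] Qs; apply: Q1; rewrite -su mulrC; apply: QM.
split; first split; first split=> [|x y Qx Qy|x y Qy] /=.
- by rewrite rmorph0.
- by rewrite rmorphD; apply: QD.
- by rewrite rmorphM; apply: QM.
- by rewrite /= rmorph1.
by move=> x y; rewrite /= rmorphM; apply: QP.
Qed.

Lemma localization_extension_prime P : is_prime P -> (forall s, S s -> ~ P s) ->
  is_prime (extension phi P) /\ phi @^-1` (extension phi P) = P.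
Proof.
move=> pP PS; have [[IP P1] PM] := pP; have [unit frac _] := locS.
have phiP : phi @^-1` (extension phi P) = P.
  apply/seteqP; split=> [r /(localization_extension_phi IP)[s /PS Ps /PM[]//]|].
  by move=> r Pr; apply: mem_ideal_gen; exists r.
have extP x s r : S s -> x * phi s = phi r -> extension phi P x <-> P r.
  move=> Ss xs; have -> : P r = extension phi P (phi r) by rewrite -{1}phiP.
  rewrite -xs.
  have IE : is_ideal (extension phi P) by apply: ideal_gen_is_ideal.
  split=> [Ex|Exs]; first exact: (ideal_mulr _ IE).
  have [v sv] := unit s Ss.
  by rewrite -(mulr1 x) -sv mulrA; apply: (ideal_mulr _ IE).
split=> //; split; first split; first exact: ideal_gen_is_ideal.
  by rewrite -(rmorph1 phi) => e1; apply: P1; rewrite -phiP.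
move=> x y; have [r [s [Ss xs]]] := frac x; have [t [u [Su yu]]] := frac y.
have [_ SM] := multS.
have xyE : x * y * phi (s * u) = phi (r * t) by rewrite !rmorphM mulrACA xs yu.
rewrite (extP _ _ _ (SM _ _ Ss Su) xyE) => /PM[].
  by left; apply/(extP _ _ _ Ss xs).
by right; apply/(extP _ _ _ Su yu).
Qed.

Lemma localization_minimal_prime P : minimal_prime P ->
  (forall s, S s -> ~ P s) -> minimal_prime (extension phi P).
Proof.
move=> [pP minP] PS; have [pE phiE] := localization_extension_prime pP PS.
split=> // Q pQ QE; have [pQ' _] := localization_preim_prime pQ.
apply/seteqP; split=> //; apply: smallest_sub; first by case: pQ => -[].
rewrite -(minP _ pQ'); first by move=> _ [r Qr <-].
by rewrite -phiE => r /QE.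
Qed.

(** Minimal primes Q of [B] contract to minimal primes of [R]: a prime inside the contraction misses
    [S], so it extends to a prime inside Q, which is Q itself. *)
Lemma localization_circ c : circ c -> circ (phi c).
Proof.
move=> cc [Q [pQ minQ] Qc]; have [pQ' QS] := localization_preim_prime pQ.
apply: cc; exists (phi @^-1` Q) => //; split=> // P pP PQ.
have PS s : S s -> ~ P s by move=> /QS Qs /PQ.
have [pE phiE] := localization_extension_prime pP PS.
rewrite -(minQ _ pE) ?phiE//; apply: smallest_sub; first by case: pQ => -[].
by move=> _ [r /PQ Qr <-].
Qed.

(* An element d + e^(n+1) avoids all minimal primes when e lies in exactly those
   that do not contain d; these include the minimal primes disjoint from S, so
   that phi e is nilpotent. *)
Lemma circ_localization_lift d : noetherian R -> circ (phi d) ->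
  exists2 d', circ d' & phi d' = phi d.
Proof.
move=> noethR cd; have [_ _ ker] := locS; have [S1 SM] := multS.
have [e [eP circe]] := circ_radical_avoidance noethR d.
have [l [lP _ nil]] := noetherian_minimal_primes noethR.
(* If d is outside P, then e is in P and 1 serves. If d is in P, then P meets [S], as otherwise
   [phi d] would lie in the minimal prime generated by P. *)
have /choice[w wP] : forall P, exists w, S w /\ (minimal_prime P -> P (w * e)).
  move=> P; have [mP|] := pselect (minimal_prime P); last by exists 1.
  have [[IP _] _] := mP.1.
  have [Pd|Pd] := pselect (P d); last first.
    by exists 1; rewrite mul1r; split=> // _; apply: eP.
  have [/localization_minimal_prime mE|] := pselect (forall s, S s -> ~ P s).
    case: cd; exists (extension phi P); first exact: mE.
    by apply: mem_ideal_gen; exists d.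
  move=> /existsNP[s /not_implyP[Ss /contrapT Ps]].
  by exists s; split=> // _; apply: ideal_mulr.
pose u := \prod_(P <- l) w P.
have [|n ue] := nil (u * e).
  move=> P mP; have [[IP _] _] := mP.1.
  have Pl : P \in l by apply/lP.
  rewrite /u (big_rem P Pl) mulrAC; apply: ideal_mulr => //.
  by apply: (wP P).2.
(* (ue)^n = 0 with u in [S] already kills e^n in [B]; [circe] asks for a positive exponent. *)
exists (d + e ^+ n.+1); first exact: circe.
rewrite rmorphD (_ : phi (e ^+ n.+1) = 0) ?addr0//; apply/ker.
exists (u ^+ n); split; last by rewrite exprSr mulrA -exprMn ue mul0r.
by apply/mult_closed_expr/mult_closed_prod => P; case: (wP P).
Qed.

Lemma localization_frob_power p n (a : set R) : is_ideal a ->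
  frob_power p n (extension phi a) `<=` extension phi (frob_power p n a).
Proof.
move=> Ia; apply: smallest_sub; first exact: ideal_gen_is_ideal.
move=> _ [x + <-].
rewrite !localization_extension//; last exact: ideal_gen_is_ideal.
move=> [s [r [Ss ar xs]]]; exists (s ^+ (p ^ n)), (r ^+ (p ^ n)); split.
- exact: mult_closed_expr.
- by apply: mem_ideal_gen; exists r.
- by rewrite !rmorphXn -exprMn xs.
Qed.

End Localization.

Lemma tight_closure_localization p (R : comNzRingType) (B : comPzRingType)
    (S : set R) (phi : {rmorphism R -> B}) (a : set R) (D : set (set R))
    (Q : set R -> nat -> set R) m0 (c : R) :
  p \in [pchar R] -> noetherian R -> is_ideal a -> weak_test_element p m0 c ->
  finite_set D -> (forall P, D P -> f_primary p P (Q P)) ->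
  (forall n, frob_closure p (frob_power p n a) = \bigcap_(P in D) Q P n) ->
  mult_closed S -> localization S phi ->
  extension phi (tight_closure p a) = tight_closure p (extension phi a).
Proof.
move=> pcharR noethR Ia testc finD fQ aQ multS locS.
have [unit frac _] := locS; have [S1 SM] := multS.
have IT := tight_closure_ideal pcharR Ia.
have IE X : is_ideal (extension phi X) by apply: ideal_gen_is_ideal.
have IF n : is_ideal (frob_power p n a) by apply: ideal_gen_is_ideal.
have IFE n : is_ideal (frob_power p n (extension phi a)).
  exact: ideal_gen_is_ideal.
rewrite (localization_extension multS locS IT); apply/seteqP; split=> x.
  move=> [s [r [Ss [d cd [N dr]] xs]]].
  exists (phi d); first exact: (localization_circ multS locS).
  exists N => n /dr dn; have [u su] := unit s Ss.
  have -> : phi d * x ^+ (p ^ n) = phi (d * r ^+ (p ^ n)) * u ^+ (p ^ n).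
    by rewrite rmorphM rmorphXn -xs -mulrA -exprMn -mulrA su mulr1.
  apply: (ideal_mulr _ (IFE n)).
  move: dn; apply: (smallest_sub
      (X := [set r | frob_power p n (extension phi a) (phi r)])).
    have [F0 FD FM] := IFE n.
    split=> [|y z Fy Fz|y z Fz] /=; rewrite ?rmorph0 ?rmorphD ?rmorphM//.
      exact: FD.
    exact: FM.
  move=> _ [y ay <-] /=; rewrite rmorphXn; apply: mem_ideal_gen.
  by exists (phi y) => //; apply: mem_ideal_gen; exists y.
move=> [d cd [N dN]]; have [r [t [St xt]]] := frac x.
have [d0 [s [Ss ds]]] := frac d.
(* The numerator of the multiplier d = d0/s again avoids the minimal primes of [B], so it is the
   image of a multiplier d' of [R]. *)
have [|d' cd' d'E] := circ_localization_lift multS locS (d := d0) noethR.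
  rewrite -ds => -[P mP]; have [_ PM] := mP.1 => /PM[Pd|Ps].
    by apply: cd; exists P.
  have [u su] := unit s Ss; have [[IP P1] _] := mP.1.
  by apply: P1; rewrite -su; apply: ideal_mulr.
have dr n : (N <= n)%N -> exists2 w, S w & frob_power p n a (w * (d' * r ^+ (p
  ^ n))).
  move=> /dN dn; apply: (localization_extension_phi multS locS) => //.
  apply: (localization_frob_power multS locS) => //.
  rewrite rmorphM d'E -ds rmorphXn -xt exprMn mulrACA.
  exact: (ideal_mulr _ (IFE n)).
have [w Sw wP] : exists2 w, S w &
    forall P, D P -> (exists2 s, S s & P s) -> Q P 0%N w.
  have /choice[w wP] : forall P, exists w,
      S w /\ (D P -> (exists2 s, S s & P s) -> Q P 0%N w).
    move=> P; have [DP|] := pselect (D P); last by exists 1.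
    have [_ /(_ 0%N)[_ rP]] := fQ P DP.
    have [[v Sv Pv]|] := pselect (exists2 s, S s & P s); last by exists 1.
    have [k vk] : radical (Q P 0%N) v by rewrite rP.
    by exists (v ^+ k); split=> //; apply: mult_closed_expr.
  have /finite_seqP[l DE] := finD.
  exists (\prod_(P <- l) w P).
    by apply: mult_closed_prod => // P; case: (wP P).
  move=> P DP PS; have [fP _] := fQ P DP; have [IQ _] := fP 0%N.
  apply: (ideal_prod (i := P)) => //; first by move: DP; rewrite DE.
  exact: (wP P).2.
(* x = r/t is written as wr/(tw), and wr is shown to lie in the tight closure: w takes care of the P
   meeting [S], cancellation of the others. *)
exists (t * w), (w * r); split; first exact: SM.
  apply: (frob_closure_tight_closure pcharR testc Ia cd' (N := N)) => n Nn.
  rewrite aQ => P DP; have [fP pP] := fQ P DP; have [IQ _] := fP n.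
  have [PS|PS] := pselect (exists2 s, S s & P s).
    rewrite exprMn mulrCA; apply: ideal_mulr => //.
    by have := (f_sequence_expr 0 n w fP).2 (wP P DP PS); rewrite add0n.
  have [v Sv] := dr n Nn.
  move=> /(sub_frob_closure p (IF n)); rewrite aQ => /(_ P DP).
  rewrite mulrC => /(pP n).1.2[Qn|]; last first.
    by rewrite (pP n).2 => Pv; case: PS; exists v.
  by rewrite exprMn mulrCA; have [_ _] := IQ; apply.
by rewrite !rmorphM mulrA xt mulrC.
Qed.

(** * Linear growth of primary decompositions *)

Section LinearGrowth.
Variables (p : nat) (R : comNzRingType).
Hypothesis pcharR : p \in [pchar R].
Variables (a : set R) (h : nat).
Hypotheses (Ia : is_ideal a) (h_gt0 : (0 < h)%N).

Definition closure_component P : nat -> set R :=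
  frob_component p
    (fun n => ideal_add (frob_power p n a) (ideal_pow (frob_power p n P) h)) P.

Section PrimeComponent.
Variable P : set R.
Hypotheses (primeP : is_prime P) (aP : a `<=` P).

Let K n := ideal_add (frob_power p n a) (ideal_pow (frob_power p n P) h).
Let IK n : is_ideal (K n). Proof. exact: ideal_gen_is_ideal. Qed.

Let stepK n x : K n x -> K n.+1 (x ^+ p).
Proof.
have [[IP _] _] := primeP.
apply: (ideal_add_sub (K := [set x | K n.+1 (x ^+ p)])) => [|y Fy|y Fy] /=.
- by have := preim_frob_ideal pcharR 1 (IK n.+1); rewrite expn1.
- by apply: mem_ideal_gen; left; apply: frob_power_step.
- by apply: mem_ideal_gen; right; apply: ideal_pow_frob_step.
Qed.

Let subK n : K n `<=` P.
Proof.
have [[IP _] _] := primeP; have FP := frob_power_sub pcharR (n := n) IP.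
apply: ideal_add_sub => //; last exact: ideal_pow_sub.
by move=> x /(frob_power_mono (p := p) aP)/FP.
Qed.

Let radK n : P `<=` radical (K n).
Proof.
move=> x Px; exists (p ^ n * h)%N; apply: mem_ideal_gen; right.
by rewrite exprM; apply: ideal_pow_expr; apply: mem_ideal_gen; exists x.
Qed.

Lemma closure_component_primary : f_primary p P (closure_component P).
Proof. exact: frob_component_primary. Qed.

Lemma closure_component_lift n r : closure_component P n r ->
  exists j, forall k, (j <= k)%N -> exists2 s, ~ P s & K (n + k) (s * r ^+ (p ^
    k)).
Proof.
move=> [j [s [Ps sr]]]; exists j => k jk.
exact: (frob_component_lift stepK primeP Ps sr jk).
Qed.

Lemma ideal_pow_closure_component n :
  ideal_pow (frob_power p n P) h `<=` closure_component P n.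
Proof.
move=> x xP; apply: (sub_frob_component p primeP).
by apply: mem_ideal_gen; right.
Qed.

Lemma frob_closure_sub_component n :
  frob_closure p (frob_power p n a) `<=` closure_component P n.
Proof.
have [[_ P1] _] := primeP.
move=> x [j]; rewrite frob_powerD// => xj; exists j, 1; rewrite mul1r.
by split=> //; apply: mem_ideal_gen; left.
Qed.

End PrimeComponent.

Let Lambda := \bigcup_n ass (frob_power p n a).

Hypotheses (finL : finite_set Lambda)
  (growth : forall n, exists (k : nat) (q : 'I_k -> set R),
      minimal_primary_decomposition (frob_power p n a) q /\
      forall i, ideal_pow (frob_power p n (radical (q i))) h `<=` q i).

Lemma ass_frob_power_prime P : Lambda P -> is_prime P /\ a `<=` P.
Proof.
move=> [n _ [k [q [[[qp qE] _ _] [i PE]]]]].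
have pP : is_prime P by rewrite PE; apply: radical_primary_prime.
split=> // x ax; apply: (prime_expr (n := p ^ n) pP).
rewrite PE; apply: sub_radical.
have : frob_power p n a (x ^+ (p ^ n)) by apply: mem_ideal_gen; exists x.
by rewrite qE => /(_ i I).
Qed.

Lemma frob_closure_bigcap n : frob_closure p (frob_power p n a) =
  \bigcap_(P in Lambda) closure_component P n.
Proof.
apply/seteqP; split=> [r ra P /ass_frob_power_prime[pP aP]|r rC].
  exact: frob_closure_sub_component.
(* Finiteness of [Lambda] yields one J for all its primes, so linear growth is needed at the single
   level n + J. *)
have [J JP] : exists J, forall P, Lambda P -> exists2 s, ~ P s &
    ideal_add (frob_power p (n + J) a) (ideal_pow (frob_power p (n + J) P) h)
      (s * r ^+ (p ^ J)).
  have /choice[j jP] : forall P, exists j, Lambda P -> forall k, (j <= k)%N ->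
      exists2 s, ~ P s & ideal_add (frob_power p (n + k) a)
        (ideal_pow (frob_power p (n + k) P) h) (s * r ^+ (p ^ k)).
    move=> P; have [LP|] := pselect (Lambda P); last by exists 0%N.
    have [pP aP] := ass_frob_power_prime LP.
    by have [j jP] := closure_component_lift pP (rC P LP); exists j.
  have /finite_seqP[l LE] := finL.
  exists (\max_(P <- l) j P) => P LP; apply: (jP P LP).
  by apply: leq_bigmax_seq => //; move: LP; rewrite LE.
exists J; rewrite frob_powerD//.
have [k [q [qmin qh]]] := growth (n + J).
have [[qp qE] _ _] := qmin.
rewrite qE => i _; have LP : Lambda (radical (q i)).
  by exists (n + J)%N => //; exists k, q; split=> //; exists i.
(* For P the radical of [q i], both summands lie in [q i], the second by linear growth; s is outside
   P and cancels. *)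
have [s Ps sr] := JP _ LP; have [[Iq _] qM] := qp i.
have : q i (s * r ^+ (p ^ J)).
  apply: (ideal_add_sub Iq _ (qh i) sr) => x.
  by rewrite qE => /(_ i I).
by rewrite mulrC => /qM[].
Qed.

End LinearGrowth.

(** * F-closures and tight closures of the Frobenius powers under linear growth *)

Theorem theorem7p14 (p : nat) (R : comNzRingType) (pcharR : p \in [pchar R])
    (noethR : noetherian R)
    (Rinf : comNzRingType) (psi0 : {rmorphism R -> Rinf})
    (perfR : perfect_closure p psi0)
    (a : set R) (proper_a : proper_id a)
    (growth_a : linear_growth p (fun n => frob_power p n a))
    (fin_ass_a : finite_set (\bigcup_n ass (frob_power p n a))) :
  let aF n := frob_closure p (frob_power p n a) in
  let aT n := tight_closure p (frob_power p n a) in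
  (* (i) *)
  (fseq_ideal p psi0 aF = extension psi0 a /\
   has_primary_decomposition (extension psi0 a)) /\
  (* (ii) *)
  linear_growth p aF /\
  (* (iii) *)
  (\bigcup_n ass (aF n) `<=` \bigcup_n ass (frob_power p n a) /\
   finite_set (\bigcup_n ass (aF n))) /\
  ((exists (m0 : nat) (c : R), weak_test_element p m0 c) ->
   (* (iv) *)
   (forall S : set R, mult_closed S ->
    forall (B : comPzRingType) (phi : {rmorphism R -> B}),
      localization S phi ->
      extension phi (tight_closure p a) = tight_closure p (extension phi a)) /\
   (* (v) *)
   (has_primary_decomposition (fseq_ideal p psi0 aT) /\
    linear_growth p aT) /\
   (* (vi) *)
   (\bigcup_n ass (aT n) `<=` \bigcup_n ass (aF n) /\
    finite_set (\bigcup_n ass (aT n)))).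
Proof.
have [Ia _] := proper_a; have [prop_a [h [h0 growth]]] := growth_a.
set L := \bigcup_n ass (frob_power p n a).
pose C := closure_component p a h.
have LP P : L P -> is_prime P /\ a `<=` P by exact: ass_frob_power_prime.
have CP P : L P -> f_primary p P (C P).
  by move=> /LP[pP aP]; apply: closure_component_primary.
have Ch P n : L P -> ideal_pow (frob_power p n P) h `<=` C P n.
  by move=> /LP[pP aP]; apply: ideal_pow_closure_component.
move=> aF aT.
have aFE : aF = fun n => \bigcap_(P in L) C P n.
  by apply/funext => n; apply: frob_closure_bigcap.
have IF n : is_ideal (frob_power p n a) by apply: ideal_gen_is_ideal.
have aF1 n : ~ aF n 1.
  by move=> [m]; rewrite expr1n frob_powerD//; case: (prop_a (n + m)%N).
have growF : linear_growth p aF.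
  rewrite aFE; apply: (linear_growth_family (h := h)) => //.
  by move=> n; have := aF1 n; rewrite aFE.
have decF : has_primary_decomposition (extension psi0 a).
  rewrite -(fseq_ideal_frob_closure pcharR perfR Ia) -/aF aFE.
  exact: has_primary_decomposition_fseq.
have CPn P n : L P -> is_primary (C P n) /\ radical (C P n) = P.
  by move=> /CP[_ /(_ n)].
have assF n : ass (aF n) `<=` L.
  rewrite aFE.
  exact: (ass_primary_family (q := fun P => C P n) fin_ass_a (fun P => @CPn P
    n)).
have assF' : \bigcup_n ass (aF n) `<=` L by move=> P [n _ /assF].
have finF := sub_finite_set assF' fin_ass_a.
split; first by split=> //; apply: fseq_ideal_frob_closure.
split=> //; split=> // -[m0 [c testc]].
split.
  move=> S multS B phi locS.
  apply: (tight_closure_localization (D := L) (Q := C)) testc _ _ _ multS locS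
    => //.
  by move=> n; rewrite -/(aF n) aFE.
(* At every n the components at primes of [L] outside [LF] are redundant; indexing by [LF] yields
   the inclusion in (vi). *)
pose LF := \bigcup_n ass (aF n).
have aFE' n : aF n = \bigcap_(P in LF) C P n.
  apply/seteqP; split=> [r|].
    by rewrite aFE => rC P /assF'; apply: rC.
  rewrite aFE (bigcap_ass_primary_family (q := fun P => C P n) fin_ass_a
    (fun P => @CPn P n)).
  move=> r rC P [DP assP]; apply: rC; exists n => //.
  by rewrite aFE.
pose T P := test_component p c (C P).
(* Primes whose test component is the whole ring are dropped; level 0 detects this for all
   levels. *)
pose D := [set P | LF P /\ ~ T P 0%N 1].
have DLF : D `<=` LF by move=> P [].
have finD : finite_set D by apply: sub_finite_set finF.
have TP P : D P -> f_primary p P (T P).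
  by move=> [/assF'/CP fC T1]; apply: test_component_primary.
have aTE : aT = fun n => \bigcap_(P in D) T P n.
  apply/funext => n; apply/seteqP; split=> r.
    move=> rT P [/assF' PL _] m.
    have [fC _] := CP P PL.
    (* The test element works from exponent p^m0 on, so c r^(p^m) is first raised to the power p^m0;
       c^(p^m0) is a multiple of c. *)
    apply/(f_sequence_expr (n + m) m0 _ fC).
    have cr : C P (n + (m + m0))%N (c * r ^+ (p ^ (m + m0))).
      have : aF (n + (m + m0))%N (c * r ^+ (p ^ (m + m0))).
        apply: sub_frob_closure => //; rewrite -frob_powerD//.
        by apply: (testc.2 _ (IF n) r).1 => //; apply: leq_addl.
      by rewrite aFE; apply.
    have [[_ _ CM] _] := fC (n + (m + m0))%N.
    rewrite -addnA exprMn -exprM -expnD -(prednK (pchar_expn_gt0 pcharR m0)).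
    by rewrite exprSr -mulrA; apply: CM.
  move=> rT; apply: (frob_closure_tight_closure (d := c) (N := 0) pcharR testc).
  - exact: IF.
  - by case: testc.
  move=> m _; rewrite frob_powerD// -/(aF (n + m)%N) aFE' => P LFP.
  have [T1|T1] := pselect (T P 0%N 1); last by apply: rT.
  have fT : f_sequence p (T P).
    by apply: test_component_f_sequence => //; case: (CP P (assF' _ LFP)).
  have Tn1 : T P n 1.
    by have := (f_sequence_expr 0 n 1 fT).2 T1; rewrite expr1n.
  have [ITn _] := fT n.
  have : T P n r by rewrite (ideal1P ITn Tn1).
  exact.
(* An empty decomposition would make the proper ideal a^[p^0] the whole ring. A prime containing a
   then keeps all the tight closures proper. *)
have [P0 LP0] : L !=set0.
  have [k [q [qmin _]]] := growth 0%N; have [[_ qE] _ _] := qmin.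
  case: k q qmin qE {growth} => [|k] q qmin qE.
    have [_ /(_ _)[]] := prop_a 0%N.
    by rewrite qE => -[].
  by exists (radical (q ord0)), 0%N => //; exists k.+1, q; split=> //;
    exists ord0.
have aT1 n : ~ aT n 1.
  have [pP0 aP0] := LP _ LP0; have [[IP0 _] _] := pP0.
  apply: (tight_closure_proper pcharR noethR pP0).
  have FP0 := frob_power_sub pcharR (n := n) IP0.
  by move=> x /(frob_power_mono (p := p) aP0)/FP0.
split.
  split; first by rewrite aTE; apply: has_primary_decomposition_fseq.
  rewrite aTE; apply: (linear_growth_family (h := h)) => //.
    (* Test components contain the components of the F-closures, so the same [h] works. *)
    move=> P n /DLF/assF' PL x /(Ch P n PL).
    by apply: sub_test_component; case: (CP P PL).
  by move=> n; have := aT1 n; rewrite aTE.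
have assT : \bigcup_n ass (aT n) `<=` LF.
  move=> P [n _]; rewrite aTE => assP; apply: DLF.
  apply: (ass_primary_family (q := fun P => T P n) finD _ assP) => Q DQ.
  by have [_] := TP Q DQ.
by split=> //; apply: sub_finite_set finF.
Qed.
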